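(* Let $\nu$ be an N-extremal measure and $\Omega'$ be an infinite subset of $\Omega:=\mathrm{supp}(\nu)$. Set $\rho=\sum_{\lambda\in\Omega\setminus\Omega'}\nu(\{\lambda\})\delta_\lambda$ (with $\rho=0$ if $\Omega'=\Omega$). Then $\rho$ is an H-determinate measure such that $\mathrm{ind}_z(\rho)=\infty$ for all $z\in\mathbb C$.
   Context: All measures are positive; $\mathbb Z_+=\{0,1,2,\ldots\}$; $\mathrm{supp}(\nu)$ is the closed support of $\nu$; $\delta_\lambda$ is the Dirac measure at $\lambda$. Let $\mathscr M$ be the set of Borel measures $\nu$ on $\mathbb R$ with $\int|t|^n\,d\nu(t)<\infty$ for all $n\in\mathbb Z_+$. A measure $\nu\in\mathscr M$ is H-determinate if it is the only measure in $\mathscr M$ with the moments $\{\int t^n\,d\nu(t)\}_{n=0}^\infty$; otherwise it is H-indeterminate. A measure $\nu\in\mathscr M$ is N-extremal if it is H-indeterminate and the complex polynomials are dense in $L^2(\nu)$ (the closed support of an N-extremal measure is countably infinite with no accumulation point in $\mathbb R$). The index of H-determinacy of an H-determinate measure $\rho$ at $z\in\mathbb C$ is $\mathrm{ind}_z(\rho)=\sup\{k\in\mathbb Z_+:|t-z|^{2k}d\rho(t)\text{ is H-determinate}\}\in\mathbb Z_+\cup\{\infty\}$. *)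

(* Defs.v *)
From HB Require Import structures.
From mathcomp Require Import all_boot all_order all_algebra.
From mathcomp Require Import all_classical all_reals all_analysis.
From mathcomp Require Import measurable_realfun complex.

Set Implicit Arguments.
Unset Strict Implicit.
Unset Printing Implicit Defensive.

Import Order.TTheory GRing.Theory Num.Theory.
Import numFieldNormedType.Exports.

Local Open Scope classical_set_scope.
Local Open Scope ring_scope.
Local Open Scope complex_scope.
Local Open Scope ereal_scope.

Notation borel_measure R := {measure set (measurableTypeR R) -> \bar R}.

Section borel_measures.
Context (R : realType).
Implicit Types (mu nu rho : borel_measure R) (z : R[i]).

Definition supp nu : set R :=
  [set x | forall U : set R, open U -> U x -> 0 < nu U].

Definition finite_moments nu : Prop :=
  forall n : nat, \int[nu]_t (`|t : R| ^+ n)%:E < +oo.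

Definition same_moments mu nu : Prop :=
  forall n : nat, \int[mu]_t ((t : R) ^+ n)%:E = \int[nu]_t ((t : R) ^+ n)%:E.

(* Measures are compared on Borel sets only: a term of type [borel_measure R]
   also carries irrelevant values on the nonmeasurable sets. *)
Definition H_determinate nu : Prop :=
  finite_moments nu /\
  forall mu, finite_moments mu -> same_moments mu nu ->
    forall A : set (measurableTypeR R), measurable A -> mu A = nu A.

Definition H_indeterminate nu : Prop :=
  finite_moments nu /\ ~ H_determinate nu.

(* Borel measurability into C = R^2 is expressed componentwise. *)
Definition complex_L2 nu (f : R -> R[i]) : Prop :=
  [/\ measurable_fun [set: measurableTypeR R] (fun t => complex.Re (f t)),
      measurable_fun [set: measurableTypeR R] (fun t => complex.Im (f t)) &
      'N[nu]_2%:E [(fun t => (Normc.normc (f t))%:E)] < +oo].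

Definition polynomials_dense_L2 nu : Prop :=
  forall f : R -> R[i], complex_L2 nu f ->
  forall e : R, (0 < e)%R ->
  exists p : {poly R[i]},
    'N[nu]_2%:E [(fun t => (Normc.normc (f t - p.[(t : R)%:C]))%:E)] < e%:E.

Definition N_extremal nu : Prop :=
  H_indeterminate nu /\ polynomials_dense_L2 nu.

End borel_measures.

Section atomic_measure.
Context (R : realType) (nu : borel_measure R) (S : set R).

Definition atomic_measure (A : set (measurableTypeR R)) : \bar R :=
  \esum_(l in S) (nu [set l] * \d_l A).

Let atomic_measure0 : atomic_measure set0 = 0.
Proof.
by rewrite /atomic_measure esum1// => l _; rewrite measure0 mule0.
Qed.

Let atomic_measure_ge0 A : 0 <= atomic_measure A.
Proof. by apply: esum_ge0 => l _; rewrite mule_ge0. Qed.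

Let atomic_measure_semi_sigma_additive : semi_sigma_additive atomic_measure.
Proof.
move=> F mF tF mUF.
suff -> : atomic_measure (\bigcup_n F n) =
    \sum_(0 <= n <oo) atomic_measure (F n).
  by apply: is_cvg_nneseries => n _ _; exact: atomic_measure_ge0.
rewrite nneseries_esumT//.
rewrite /atomic_measure (@esum_esum _ _ _ setT (fun=> S)
  (fun n l => nu [set l] * \d_l (F n))); last first.
  by move=> n l; rewrite mule_ge0.
have -> : \esum_(l in S) (nu [set l] * \d_l (\bigcup_n F n)) =
    \esum_(l in S) \esum_(n in [set: nat]) (nu [set l] * \d_l (F n)).
  apply: eq_esum => l _.
  rewrite -nneseries_esumT; last by move=> n; rewrite mule_ge0.
  have [[n _ Fnl]|Fl] := pselect ((\bigcup_n F n) l).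
    rewrite (@nneseriesD1 _ _ n)//; last by move=> m _; rewrite mule_ge0.
    rewrite eseries0 ?adde0; last first.
      move=> m _ /= mn; rewrite diracE memNset ?mule0// => Fml.
      by case/eqP: mn; apply: tF => //; exists l.
    by rewrite !diracE !mem_set//; exists n.
  rewrite diracE memNset// mule0 eseries0// => n _ _.
  by rewrite diracE memNset ?mule0// => Fnl; apply: Fl; exists n.
rewrite (@esum_esum _ _ _ S (fun=> setT) (fun l n => nu [set l] * \d_l (F n))).
  2: by move=> l n; rewrite mule_ge0.
rewrite (reindex_esum (S `*`` (fun=> setT)) _ (fun x => (x.2, x.1)))//.
split=> [[l n] [/= Sl _]//|[l n] [l' n'] _ _ /= [-> ->]//|[n l] [_ /= Sl]].
by exists (l, n).
Qed.

HB.instance Definition _ := isMeasure.Build _ _ _ atomic_measure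
  atomic_measure0 atomic_measure_ge0 atomic_measure_semi_sigma_additive.

End atomic_measure.

Section power_weighted_measure.
Context (R : realType) (rho : borel_measure R) (z : R[i]) (k : nat).

Let w (t : R) : R := (Normc.normc (t%:C - z) ^+ (2 * k))%R.

Definition power_weighted_measure (A : set (measurableTypeR R)) : \bar R :=
  \int[rho]_(t in A) (Normc.normc ((t : R)%:C - z) ^+ (2 * k))%:E.

Let w_ge0 t : (0 <= w t)%R.
Proof. by apply: exprn_ge0; case: (_ - _)%R => a b; exact: sqrtr_ge0. Qed.

Let measurable_w : measurable_fun [set: measurableTypeR R] w.
Proof.
have -> : w = fun t => (((t - complex.Re z) ^+ 2 + complex.Im z ^+ 2) ^+ k)%R.
  apply/funext => t; rewrite /w exprM; congr (_ ^+ k)%R.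
  case: z => a b /=; rewrite sqr_sqrtr ?addr_ge0 ?sqr_ge0//.
  by rewrite sub0r sqrrN.
apply: measurable_funX; apply: measurable_funD => //.
by apply: measurable_funX; exact: measurable_funB.
Qed.

Let power_weighted_measure0 : power_weighted_measure set0 = 0.
Proof. exact: integral_set0. Qed.

Let power_weighted_measure_ge0 A : 0 <= power_weighted_measure A.
Proof. by apply: integral_ge0 => t _; rewrite lee_fin w_ge0. Qed.

Let power_weighted_measure_semi_sigma_additive :
  semi_sigma_additive power_weighted_measure.
Proof.
move=> F mF tF mUF; rewrite /power_weighted_measure ge0_integral_bigcup//.
- by apply: is_cvg_nneseries => n _ _; exact: power_weighted_measure_ge0.
- by apply: measurable_funTS; apply/measurable_EFinP; exact: measurable_w.
- by move=> t _; rewrite lee_fin w_ge0.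
Qed.

HB.instance Definition _ := isMeasure.Build _ _ _ power_weighted_measure
  power_weighted_measure0 power_weighted_measure_ge0
  power_weighted_measure_semi_sigma_additive.

End power_weighted_measure.

(* The index is used for H-determinate [rho] only; the exponent k = 0 then
   belongs to the set, so the supremum is a natural number or +oo. *)
Definition H_index (R : realType) (rho : borel_measure R) (z : R[i]) : \bar R :=
  ereal_sup [set (k%:R : R)%:E |
    k in [set k : nat | H_determinate (power_weighted_measure rho z k)]].

(* Main.v *)
Require Import Defs.
From HB Require Import structures.
From mathcomp Require Import all_boot all_order all_algebra.
From mathcomp Require Import all_classical all_reals all_analysis.
From mathcomp Require Import measurable_realfun complex ring lra.

(** The theorem rests on two facts, the discreteness of N-extremal measures and
a criterion of determinacy, joined by a division argument.

Division.  Every point of the support of [nu] is an isolated atom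
([supp_isolated]).  Fix [m], choose [m.+1] points of [Omega'], and let [q] be
the monic polynomial with these simple roots.  Since [nu] charges the chosen
points, polynomials converging to the indicator of another atom [l] in
L^2([nu]) take values tending to 0 there, and can be corrected so as to be
multiples of [q] ([nodal_approximation]).  On the support of [rho] the
variable stays away from the roots of [q], so that q^2 dominates
(1 + t^2)^(m+1) there ([nodal_weight]).  After division by [q], polynomials
therefore approximate the indicator of [l] in L^2((1 + t^2)^(m+1) rho).  As
[Omega'] is infinite, [m] is arbitrary, and each of the measures
|t - z|^(2k) rho inherits this approximation with a factor 1 + t^2 to spare
([determinate_of_domination]).

Determinacy.  Let sigma be carried by countably many atoms, and let polynomials
p tend to the indicator of an atom [l] in L^2((1 + t^2) sigma).  Then the
integral of 2 p - p^2 tends to sigma {l} and the integral of (t - l)^2 p^2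
tends to 0.  Both integrals only depend on the moments.  For another measure mu
with these moments the second one localizes p near [l], and 2 p - p^2 <= 1
yields sigma {l} <= mu {l}.  Summation over the atoms and equality of the total
masses force mu = sigma ([determinate_of_approximation]).

Discreteness.  If mu and nu are distinct with the same moments, then the
integrals of 1/w differ for some polynomial w >= 1 ([eq_measure_rational]).
Let (v) be the largest ideal of polynomials on which the functional sending g to
the integral of g/w with respect to mu - nu vanishes.  It contains w but not 1,
and the nondegeneracy of the functional modulo (v) bounds the remainder of p
modulo v by the L^2 norm of p.  Put p = v * A p + (remainder).  Multiplication by
1/v being symmetric, the entry <A P_n, P_k> for k < n of A in an orthonormal
basis is a finite sum of products of square-summable sequences in n and k, and a
discrete Gronwall argument bounds the sum of the P_n(x)^2 locally uniformly in x
([evaluation_bounded]).  So p(x)^2 <= K * (integral of p^2) for x in a bounded set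
([evaluation_bounded_of_indeterminate]).  When polynomials are dense, applying
this to approximants of indicators shows that the mass of a subset of a bounded
interval is either 0 or bounded below ([small_sets_null]), which leaves only
isolated atoms. *)

Set Implicit Arguments.
Unset Strict Implicit.
Unset Printing Implicit Defensive.

Import Order.TTheory GRing.Theory Num.Theory.
Import numFieldNormedType.Exports.

Local Open Scope classical_set_scope.
Local Open Scope ring_scope.

(** * Functions of polynomial growth *)

Section tempered.
Context (R : realType).
Implicit Types (f g : measurableTypeR R -> R) (p : {poly R}) (mu nu : borel_measure R).

(** This class contains polynomials, indicators and the functions 1/w for a
polynomial w >= 1, is stable under ring operations, and is integrable
for every measure with finite moments; working inside it discharges all
integrability conditions uniformly. *)
Definition tempered f : Prop :=
  measurable_fun [set: measurableTypeR R] f /\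
  exists C n, forall t : R, `|f t| <= C * (1 + t ^+ 2) ^+ n.

Lemma tempered_measurable f : tempered f -> measurable_fun [set: measurableTypeR R] f.
Proof. by case. Qed.

Let weight_ge1 (t : R) n : 1 <= (1 + t ^+ 2) ^+ n.
Proof. by rewrite exprn_ege1// lerDl sqr_ge0. Qed.

Lemma tempered_cst (c : R) : tempered (fun=> c).
Proof.
split; first exact: measurable_cst.
by exists `|c|, 0%N => t; rewrite expr0 mulr1.
Qed.

Lemma tempered_id : tempered (fun t => t).
Proof.
split; first exact: measurable_id.
exists 1, 1%N => t; rewrite expr1 mul1r ler_norml; apply/andP; split; nra.
Qed.

Lemma temperedD f g : tempered f -> tempered g -> tempered (fun t => f t + g t).
Proof.
move=> [mf [C [n fC]]] [mg [D [k gD]]]; split; first exact: measurable_funD.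
exists (C + D), (n + k)%N => t.
rewrite (le_trans (ler_normD _ _))// mulrDl exprD lerD//.
- rewrite (le_trans (fC t))// mulrA ler_peMr//.
  exact: le_trans (fC t).
- rewrite (le_trans (gD t))// mulrCA ler_peMl//.
  exact: le_trans (gD t).
Qed.

Lemma temperedM f g : tempered f -> tempered g -> tempered (fun t => f t * g t).
Proof.
move=> [mf [C [n fC]]] [mg [D [k gD]]]; split; first exact: measurable_funM.
exists (C * D), (n + k)%N => t.
by rewrite normrM exprD mulrACA ler_pM.
Qed.

Lemma temperedZ c f : tempered f -> tempered (fun t => c * f t).
Proof. by move=> tf; apply: temperedM => //; exact: tempered_cst. Qed.

Lemma temperedN f : tempered f -> tempered (fun t => - f t).
Proof.
move=> /(temperedZ (-1)); congr tempered; apply/funext => t.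
by rewrite mulN1r.
Qed.

Lemma temperedB f g : tempered f -> tempered g -> tempered (fun t => f t - g t).
Proof. by move=> tf /temperedN; exact: temperedD. Qed.

Lemma temperedX f n : tempered f -> tempered (fun t => f t ^+ n).
Proof.
move=> tf; elim: n => [|n IH]; first exact: tempered_cst.
rewrite (_ : (fun _ => _) = (fun t => f t * f t ^+ n)); first exact: temperedM.
by apply/funext => t; rewrite exprS.
Qed.

Lemma tempered_pow n : tempered (fun t => t ^+ n).
Proof. by apply: temperedX; exact: tempered_id. Qed.

Lemma tempered_sum (I : Type) (s : seq I) (F : I -> measurableTypeR R -> R) :
  (forall i, tempered (F i)) -> tempered (fun t => \sum_(i <- s) F i t).
Proof.
move=> tF; elim: s => [|i s IH].
  rewrite (_ : (fun _ => _) = fun=> 0); first exact: tempered_cst.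
  by apply/funext => t; rewrite big_nil.
rewrite (_ : (fun _ => _) = (fun t => F i t + \sum_(j <- s) F j t)).
  exact: temperedD.
by apply/funext => t; rewrite big_cons.
Qed.

Lemma tempered_poly p : tempered (fun t => p.[t]).
Proof.
elim/poly_ind: p => [|p c IH].
  rewrite (_ : (fun _ => _) = fun=> 0); first exact: tempered_cst.
  by apply/funext => t; rewrite horner0.
rewrite (_ : (fun _ => _) = (fun t => p.[t] * t + c)).
  apply: temperedD; last exact: tempered_cst.
  by apply: temperedM => //; exact: tempered_id.
by apply/funext => t; rewrite hornerMXaddC.
Qed.

Lemma tempered_indic (A : set (measurableTypeR R)) :
  measurable A -> tempered (\1_A : _ -> R).
Proof.
move=> mA; split; first exact: measurable_indic.
by exists 1, 0%N => t; rewrite expr0 mulr1 indicE; case: (_ \in _); rewrite /= ?normr1 ?normr0.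
Qed.

Lemma integrable_power mu n : finite_moments mu ->
  mu.-integrable setT (fun t : R => (t ^+ n)%:E).
Proof.
move=> fm; apply/integrableP; split.
  by apply/measurable_EFinP; exact: (tempered_measurable (tempered_pow n)).
apply: le_lt_trans (fm n); apply: ge0_le_integral => //=.
- apply/measurable_EFinP; apply: measurableT_comp; first exact: normr_measurable.
  exact: (tempered_measurable (tempered_pow n)).
- by apply/measurable_EFinP; apply: measurable_funX; exact: normr_measurable.
- by move=> t _; rewrite lee_fin normrX.
Qed.

Lemma integrable_poly mu p : finite_moments mu ->
  mu.-integrable setT (fun t : R => (p.[t])%:E).
Proof.
move=> fm.
rewrite (_ : (fun _ => _) = (fun t => \sum_(i < size p) ((p`_i)%:E * (t ^+ i)%:E))%E).
  apply: integrable_sum => // i _; apply: integrableZl => //.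
  exact: integrable_power.
by apply/funext => t; rewrite horner_coef -sumEFin.
Qed.

Lemma tempered_integrable mu f : finite_moments mu -> tempered f ->
  mu.-integrable setT (EFin \o f).
Proof.
move=> fm [mf [C [n fC]]].
apply: (le_integrable measurableT _ _ (integrable_poly (C *: (1 + 'X ^+ 2) ^+ n) fm)).
  exact/measurable_EFinP.
move=> t _ /=; rewrite lee_fin !hornerE.
by rewrite (le_trans (fC t))// ler_norm.
Qed.

Lemma Rintegral_temperedD mu f g : finite_moments mu -> tempered f -> tempered g ->
  \int[mu]_t (f t + g t) = \int[mu]_t f t + \int[mu]_t g t.
Proof. by move=> fm tf tg; rewrite RintegralD//; exact: tempered_integrable. Qed.

Lemma Rintegral_temperedB mu f g : finite_moments mu -> tempered f -> tempered g ->
  \int[mu]_t (f t - g t) = \int[mu]_t f t - \int[mu]_t g t.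
Proof. by move=> fm tf tg; rewrite RintegralB//; exact: tempered_integrable. Qed.

Lemma Rintegral_temperedZ mu c f : finite_moments mu -> tempered f ->
  \int[mu]_t (c * f t) = c * \int[mu]_t f t.
Proof. by move=> fm tf; rewrite RintegralZl//; exact: tempered_integrable. Qed.

Lemma le_Rintegral_tempered mu f g : finite_moments mu -> tempered f -> tempered g ->
  (forall t : R, f t <= g t) -> \int[mu]_t f t <= \int[mu]_t g t.
Proof. by move=> fm tf tg fg; apply: le_Rintegral => //; exact: tempered_integrable. Qed.

Lemma Rintegral_tempered_sum mu (I : Type) (s : seq I) (F : I -> measurableTypeR R -> R) :
  finite_moments mu -> (forall i, tempered (F i)) ->
  \int[mu]_t (\sum_(i <- s) F i t) = \sum_(i <- s) \int[mu]_t F i t.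
Proof.
move=> fm tF; elim: s => [|i s IH].
  under eq_Rintegral do rewrite big_nil.
  by rewrite big_nil Rintegral_cst// mul0r.
under eq_Rintegral do rewrite big_cons.
by rewrite big_cons Rintegral_temperedD// ?IH//; exact: tempered_sum.
Qed.

Lemma integral_tempered mu f : finite_moments mu -> tempered f ->
  (\int[mu]_t (f t)%:E = (\int[mu]_t f t)%R%:E)%E.
Proof.
move=> fm tf; rewrite /Rintegral fineK//.
exact: (integrable_fin_num _ (tempered_integrable fm tf)).
Qed.

Lemma finite_moments_lty mu (A : set (measurableTypeR R)) :
  finite_moments mu -> measurable A -> (mu A < +oo)%E.
Proof.
move=> fm mA; apply: le_lt_trans (fm 0%N).
under eq_integral do rewrite expr0.
by rewrite integral_cst// mul1e le_measure// inE.
Qed.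

Lemma Rintegral_indic mu (A : set (measurableTypeR R)) : measurable A ->
  \int[mu]_t (\1_A t : R) = fine (mu A).
Proof. by move=> mA; rewrite /Rintegral integral_indic// setIT. Qed.

Lemma same_moments_poly mu nu p : finite_moments mu -> finite_moments nu ->
  same_moments mu nu -> \int[mu]_t p.[t] = \int[nu]_t p.[t].
Proof.
move=> fmu fnu smu.
under eq_Rintegral do rewrite horner_coef.
under [RHS]eq_Rintegral do rewrite horner_coef.
have tF (i : 'I_(size p)) : tempered (fun t : R => p`_i * t ^+ i).
  exact/temperedZ/tempered_pow.
rewrite !Rintegral_tempered_sum//; apply: eq_bigr => i _.
rewrite !Rintegral_temperedZ//; try exact: tempered_pow.
by rewrite /Rintegral smu.
Qed.

(** The discriminant argument behind all the Cauchy-Schwarz inequalities below,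
including the degenerate case [a = 0]. *)
Lemma sqr_le_mul_of_quadratic (a b c : R) : 0 <= a -> 0 <= c ->
  (forall x, 0 <= a * x ^+ 2 - 2 * b * x + c) -> b ^+ 2 <= a * c.
Proof.
move=> a0 c0 H; have [a_eq0|a_neq0] := eqVneq a 0.
  have [->|b0] := eqVneq b 0; first by rewrite expr0n /= mulr_ge0.
  have := H ((c + 1) / (2 * b)); rewrite a_eq0 mul0r add0r.
  have -> : 2 * b * ((c + 1) / (2 * b)) = c + 1 by field.
  by lra.
have a_gt0 : 0 < a by rewrite lt0r a_neq0.
have := H (b / a).
have -> : a * (b / a) ^+ 2 - 2 * b * (b / a) + c = (a * c - b ^+ 2) / a by field.
by rewrite pmulr_lge0 ?invr_gt0// subr_ge0.
Qed.

Lemma cauchy_schwarz_integral mu f g : finite_moments mu -> tempered f -> tempered g ->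
  (\int[mu]_t (f t * g t)) ^+ 2 <=
  (\int[mu]_t (f t ^+ 2)) * (\int[mu]_t (g t ^+ 2)).
Proof.
move=> fm tf tg; have tfg := temperedM tf tg.
have tf2 := temperedX 2 tf; have tg2 := temperedX 2 tg.
apply: sqr_le_mul_of_quadratic => [||x].
- by apply: Rintegral_ge0 => t _; exact: sqr_ge0.
- by apply: Rintegral_ge0 => t _; exact: sqr_ge0.
have -> : (\int[mu]_t (f t ^+ 2)) * x ^+ 2 - 2 * (\int[mu]_t (f t * g t)) * x +
    \int[mu]_t (g t ^+ 2) =
    \int[mu]_t (x ^+ 2 * f t ^+ 2 - (2 * x) * (f t * g t) + g t ^+ 2).
  rewrite Rintegral_temperedD//; last exact/temperedB/temperedZ/tfg/temperedZ.
  rewrite Rintegral_temperedB//; try exact: temperedZ.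
  by rewrite !Rintegral_temperedZ//; ring.
apply: Rintegral_ge0 => t _.
have -> : x ^+ 2 * f t ^+ 2 - 2 * x * (f t * g t) + g t ^+ 2 = (x * f t - g t) ^+ 2 by ring.
exact: sqr_ge0.
Qed.

End tempered.

(** * Orthonormal polynomials *)

Lemma cauchy_schwarz_sum (R : realType) (I : finType) (x y : I -> R) :
  (\sum_i x i * y i) ^+ 2 <= (\sum_i x i ^+ 2) * (\sum_i y i ^+ 2).
Proof.
apply: sqr_le_mul_of_quadratic => [||z].
- by apply: sumr_ge0 => i _; exact: sqr_ge0.
- by apply: sumr_ge0 => i _; exact: sqr_ge0.
rewrite mulr_suml mulr_sumr mulr_suml -sumrB -big_split /=.
apply: sumr_ge0 => i _.
have -> : x i ^+ 2 * z ^+ 2 - 2 * (x i * y i) * z + y i ^+ 2 = (x i * z - y i) ^+ 2 by ring.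
exact: sqr_ge0.
Qed.

Section orthonormal.
Context (R : realType) (ip : {poly R} -> {poly R} -> R).
Implicit Types (p q r : {poly R}) (P : nat -> {poly R}).
Hypothesis ipC : forall p q, ip p q = ip q p.
Hypothesis ip_linear : forall a p q r, ip (a *: p + q) r = a * ip p r + ip q r.
Hypothesis ip_gt0 : forall p, p != 0 -> 0 < ip p p.

Let ip0 r : ip 0 r = 0.
Proof. by have := ip_linear (-1) 0 0 r; rewrite scaler0 addr0 mulN1r addNr. Qed.

Let ipZ a p r : ip (a *: p) r = a * ip p r.
Proof. by rewrite -[a *: p]addr0 ip_linear ip0 addr0. Qed.

Let ipD p q r : ip (p + q) r = ip p r + ip q r.
Proof. by rewrite -[p]scale1r ip_linear mul1r scale1r. Qed.

Let ipB p q r : ip (p - q) r = ip p r - ip q r.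
Proof. by rewrite -scaleN1r ipD ipZ mulN1r. Qed.

Let ip_sum I (s : seq I) (F : I -> {poly R}) r :
  ip (\sum_(i <- s) F i) r = \sum_(i <- s) ip (F i) r.
Proof. by elim: s => [|i s IH]; rewrite ?big_nil ?ip0// !big_cons ipD IH. Qed.

(** The span condition is stated degree by degree, so that initial segments of
the family are bases of the corresponding spaces of polynomials.  Finite
families suffice, as the bounds derived from them do not depend on [n]. *)
Definition orthonormal_basis (n : nat) (P : nat -> {poly R}) : Prop :=
  (forall j k, (j < n)%N -> (k < n)%N -> ip (P j) (P k) = (j == k)%:R) /\
  (forall k, (k < n)%N -> (size (P k) <= k.+1)%N) /\
  (forall k q, (k <= n)%N -> (size q <= k)%N ->
     q = \sum_(j < k) ip q (P j) *: P j).

Lemma ortho_degree n P k q : orthonormal_basis n P -> (k < n)%N ->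
  (size q <= k)%N -> ip q (P k) = 0.
Proof.
move=> [oP [_ eP]] kn qk; rewrite (eP k q (ltnW kn) qk) ip_sum big1// => j _.
by rewrite ipZ oP ?(ltn_trans (ltn_ord j))// ltn_eqF ?mulr0.
Qed.

(** Gram-Schmidt, applied to the monomials. *)
Lemma orthonormal_basis_exists n : exists P, orthonormal_basis n P.
Proof.
elim: n => [|n [P bP]].
  exists (fun=> 0); split => //; split => // k q; rewrite leqn0 => /eqP ->.
  by rewrite leqn0 size_poly_eq0 => /eqP ->; rewrite big_ord0.
have [oP [sP eP]] := bP.
pose S := \sum_(j < n) ip 'X^n (P j) *: P j.
have sS : (size S <= n)%N.
  apply: leq_trans (size_sum _ _ _) _; apply/bigmax_leqP => j _.
  by rewrite (leq_trans (size_scale_leq _ _))// (leq_trans (sP _ _)).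
pose y := 'X^n - S.
have yn : y`_n = 1 by rewrite coefB coefXn eqxx nth_default// subr0.
have sy : (size y <= n.+1)%N.
  rewrite (leq_trans (size_polyD _ _))// size_polyXn size_polyN geq_max leqnn/=.
  exact: leq_trans sS _.
have y0 : y != 0 by apply/eqP => y0; move: yn; rewrite y0 coef0 => /esym/eqP; rewrite oner_eq0.
have yy := ip_gt0 y0.
have [c c0 cc] : exists2 c, c != 0 & c * c = ip y y.
  exists (Num.sqrt (ip y y)); first by rewrite gt_eqF// sqrtr_gt0.
  by rewrite -expr2 sqr_sqrtr// ltW.
have oy k : (k < n)%N -> ip y (P k) = 0.
  move=> kn; rewrite ipB /S ip_sum (bigD1 (Ordinal kn))//= ipZ oP// eqxx mulr1.
  rewrite big1 ?addr0 ?subrr// => j jk; rewrite ipZ oP//.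
  by case: eqP => [jk'|]; rewrite ?mulr0//; case/eqP: jk; exact: val_inj.
pose Q k := if (k < n)%N then P k else c^-1 *: y.
have QP k : (k < n)%N -> Q k = P k by rewrite /Q => ->.
have Qn : Q n = c^-1 *: y by rewrite /Q ltnn.
exists Q; split; [|split].
- move=> j k; rewrite ltnS leq_eqVlt => /predU1P[->|jn];
    rewrite ltnS leq_eqVlt => /predU1P[->|kn].
  + by rewrite Qn ipZ ipC ipZ eqxx -cc mulKf// mulVf.
  + by rewrite Qn QP// ipZ oy// mulr0 gtn_eqF.
  + by rewrite Qn QP// ipC ipZ oy// mulr0 ltn_eqF.
  + by rewrite !QP// oP.
- move=> k; rewrite ltnS leq_eqVlt => /orP[/eqP ->|kn]; last by rewrite QP// sP.
  by rewrite Qn (leq_trans (size_scale_leq _ _)).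
move=> k q; rewrite leq_eqVlt => /orP[/eqP -> qn|]; last first.
  rewrite ltnS => kn qk; rewrite {1}(eP k q kn qk); apply: eq_bigr => j _.
  by rewrite QP// (leq_trans (ltn_ord j)).
pose r := q - q`_n *: y.
have rn : (size r <= n)%N.
  apply/leq_sizeP => j; rewrite leq_eqVlt => /orP[/eqP <-|nj].
    by rewrite coefB coefZ yn mulr1 subrr.
  rewrite coefB coefZ (nth_default _ (leq_trans qn nj)).
  by rewrite (nth_default _ (leq_trans sy nj)) mulr0 subr0.
rewrite big_ord_recr/= Qn.
have qE : q = r + q`_n *: y by rewrite subrK.
have ry : ip r y = 0.
  rewrite (eP n r (leqnn n) rn) ip_sum big1// => j _.
  by rewrite ipZ (ipC (P j)) oy// mulr0.
have -> : ip q (c^-1 *: y) *: (c^-1 *: y) = q`_n *: y.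
  rewrite scalerA; congr (_ *: _); rewrite ipC ipZ ipC {1}qE ipD ry add0r ipZ -cc.
  by field.
rewrite {1}qE {1}(eP n r (leqnn n) rn); congr (_ + _); apply: eq_bigr => j _.
by rewrite QP// ipB ipZ oy// mulr0 subr0.
Qed.

(** Bessel: test the hypothesis on the polynomial representing [l] on the span of
the family. *)
Lemma bessel n P (l : {poly R} -> R) C : orthonormal_basis n P ->
  (forall a p q, l (a *: p + q) = a * l p + l q) ->
  (forall p, l p ^+ 2 <= C * ip p p) -> \sum_(k < n) l (P k) ^+ 2 <= C.
Proof.
move=> [oP _] l_linear lC; set Y := \sum_(k < n) _.
have l0 : l 0 = 0 by have := l_linear (-1) 0 0; rewrite scaler0 addr0 mulN1r addNr.
have lZ a p : l (a *: p) = a * l p by rewrite -[a *: p]addr0 l_linear l0 addr0.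
have l_sum I (s : seq I) (F : I -> {poly R}) :
    l (\sum_(i <- s) F i) = \sum_(i <- s) l (F i).
  elim: s => [|i s IH]; rewrite ?big_nil ?l0// !big_cons -IH.
  by rewrite -[F i]scale1r l_linear mul1r scale1r.
pose y := \sum_(k < n) l (P k) *: P k.
have ly : l y = Y by rewrite l_sum; apply: eq_bigr => k _; rewrite lZ expr2.
have yP (k : 'I_n) : ip y (P k) = l (P k).
  rewrite ip_sum (bigD1 k)//= ipZ oP// eqxx mulr1 big1 ?addr0// => j jk.
  by rewrite ipZ oP// (inj_eq val_inj) (negbTE jk) mulr0.
have yy : ip y y = Y.
  by rewrite {1}/y ip_sum; apply: eq_bigr => k _; rewrite ipZ ipC yP expr2.
have Y0 : 0 <= Y by apply: sumr_ge0 => k _; exact: sqr_ge0.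
have := lC y; rewrite ly yy.
have [->|Yn0] := eqVneq Y 0; last first.
  by rewrite expr2 ler_pM2r// lt0r Yn0.
by move=> _; have := lC 1; have := sqr_ge0 (l 1); have := ip_gt0 (oner_neq0 {poly R}); nra.
Qed.

End orthonormal.

(** * Local bounds for point evaluations *)

Lemma poly_bounded (R : realType) (p : {poly R}) (M : R) :
  exists2 B, 0 <= B & forall x, `|x| <= M -> p.[x] ^+ 2 <= B.
Proof.
pose D := \sum_(i < size p) `|p`_i| * M ^+ i.
exists (D ^+ 2) => [|x xM]; first exact: sqr_ge0.
have M0 : 0 <= M := le_trans (normr_ge0 x) xM.
have D0 : 0 <= D by apply: sumr_ge0 => i _; rewrite mulr_ge0// exprn_ge0.
rewrite -real_normK ?num_real// ler_sqr ?nnegrE// horner_coef.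
apply: le_trans (ler_norm_sum _ _ _) _; apply: ler_sum => i _.
by rewrite normrM normrX ler_wpM2l// lerXn2r// nnegrE.
Qed.

Section evaluation.
Context (R : realType) (ip : {poly R} -> {poly R} -> R).
Implicit Types (p q r : {poly R}) (P : nat -> {poly R}).
Hypothesis ipC : forall p q, ip p q = ip q p.
Hypothesis ip_linear : forall a p q r, ip (a *: p + q) r = a * ip p r + ip q r.
Hypothesis ip_gt0 : forall p, p != 0 -> 0 < ip p p.
Variables (v : {poly R}) (m : nat).
Hypothesis vm : size v = m.+2.
Variables (U : 'I_m.+1 -> {poly R} -> R) (C : R).
Hypothesis U_linear : forall i a p q, U i (a *: p + q) = a * U i p + U i q.
Let s (i : 'I_m.+1) p := (p %% v)`_i.
Hypothesis UC : forall i p, U i p ^+ 2 <= C * ip p p.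
Hypothesis sC : forall i p, s i p ^+ 2 <= C * ip p p.
Hypothesis skew : forall p q,
  ip (p %/ v) q + \sum_i s i p * U i q = ip p (q %/ v) + \sum_i s i q * U i p.

Let v0 : v != 0. Proof. by rewrite -size_poly_eq0 vm. Qed.

Let s_linear i a p q : s i (a *: p + q) = a * s i p + s i q.
Proof. by rewrite /s modpD modpZl coefD coefZ. Qed.

Let alpha p := \sum_i (s i p ^+ 2 + U i p ^+ 2).

Let alpha_ge0 p : 0 <= alpha p.
Proof. by apply: sumr_ge0 => i _; rewrite addr_ge0// sqr_ge0. Qed.

Let B := \sum_(i < m.+1) (C + C).

Let sum_alpha n P : orthonormal_basis ip n P -> \sum_(k < n) alpha (P k) <= B.
Proof.
move=> bP; rewrite exchange_big/=; apply: ler_sum => i _.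
rewrite big_split/= lerD//.
  exact: (bessel ipC ip_linear ip_gt0 bP (s_linear i)).
exact: (bessel ipC ip_linear ip_gt0 bP (U_linear i)).
Qed.

Let quotient_coef n P k l : orthonormal_basis ip n P -> (k < l)%N -> (l < n)%N ->
  ip (P l %/ v) (P k) ^+ 2 <= alpha (P k) * alpha (P l).
Proof.
move=> bP kl ln; have := skew (P l) (P k).
have -> : ip (P l) (P k %/ v) = 0.
  rewrite ipC; apply: (ortho_degree ip_linear bP) => //.
  rewrite size_divp// vm /=; case: (bP) => _ [sP _].
  by rewrite (leq_trans (leq_subr _ _))// (leq_trans (sP _ (ltn_trans kl ln))).
rewrite add0r => /(canRL (addrK _)) ->.
apply: sqr_le_mul_of_quadratic => // x.
rewrite -sumrB !mulr_suml mulr_sumr mulr_suml -sumrB -big_split /=.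
apply: sumr_ge0 => i _.
set a := s i (P k); set b := U i (P k); set c := s i (P l); set d := U i (P l).
have -> : (a ^+ 2 + b ^+ 2) * x ^+ 2 - 2 * (a * d - c * b) * x + (c ^+ 2 + d ^+ 2)
  = (a * x - d) ^+ 2 + (b * x + c) ^+ 2 by ring.
by rewrite addr_ge0// sqr_ge0.
Qed.

Let sumsq P n x := \sum_(k < n) (P k).[x] ^+ 2.

Let sumsq_ge0 P n x : 0 <= sumsq P n x.
Proof. by apply: sumr_ge0 => k _; exact: sqr_ge0. Qed.

(** Let [A p] be the quotient of [p] by [v].  For an orthonormal basis [P], the
hypothesis [skew] expresses <A P_l, P_k> for k < l through the sequences
s_i (P_k) and U_i (P_k), because <P_l, A P_k> = 0 by degree.  Hence
P_l(x) = v(x) * (sum over k < l of <A P_l, P_k> P_k(x)) + remainder satisfies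
P_l(x)^2 <= L * alpha (P_l) * (1 + sum over k < l of P_k(x)^2), where
the sum of the [alpha (P_l)] is bounded independently of the degree by Bessel.
The discrete Gronwall inequality concludes. *)
Lemma evaluation_bounded M : exists2 K, 0 <= K &
  forall x, `|x| <= M -> forall p, p.[x] ^+ 2 <= K * ip p p.
Proof.
have [V V0 vV] := poly_bounded v M.
have [X X0 xX] : exists2 X, 0 <= X &
    forall x, `|x| <= M -> \sum_(i < m.+1) (x ^+ i) ^+ 2 <= X.
  have [X X0 xX] := poly_bounded 'X M.
  exists (\sum_(i < m.+1) X ^+ i) => [|x xM].
    by apply: sumr_ge0 => i _; rewrite exprn_ge0.
  apply: ler_sum => i _; rewrite exprAC lerXn2r ?nnegrE ?sqr_ge0//.
  by have := xX x xM; rewrite hornerX.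
pose L := 2 * V * B + 2 * X.
exists (expR (L * B)) => [|x xM p]; first exact: expR_ge0.
have [P bP] := orthonormal_basis_exists ipC ip_linear ip_gt0 (size p).
set n := size p in bP.
have [oP [sP eP]] := bP.
have B0 : 0 <= B by apply: le_trans (sum_alpha bP); apply: sumr_ge0.
have L0 : 0 <= L by rewrite addr_ge0// !mulr_ge0.
have step l : (l < n)%N -> (P l).[x] ^+ 2 <= alpha (P l) * L * (1 + sumsq P l x).
  move=> ln.
  have Al : (size (P l %/ v)%R <= l)%N.
    by rewrite size_divp// vm /= leq_subLR (leq_trans (sP _ ln))// addSn ltnS leq_addl.
  have -> : (P l).[x] = v.[x] * (\sum_(k < l) ip (P l %/ v) (P k) * (P k).[x])
      + \sum_(i < m.+1) s i (P l) * x ^+ i.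
    rewrite {1}(divp_eq (P l) v) hornerD hornerM mulrC; congr (_ * _ + _).
      rewrite {1}(eP l _ (ltnW ln) Al) horner_sum; apply: eq_bigr => k _.
      by rewrite hornerZ.
    rewrite (@horner_coef_wide _ m.+1)//.
    by have := ltn_modp (P l) v; rewrite v0 vm ltnS.
  have h1 : (\sum_(k < l) ip (P l %/ v) (P k) * (P k).[x]) ^+ 2 <=
      alpha (P l) * B * sumsq P l x.
    apply: le_trans (cauchy_schwarz_sum _ _) (ler_wpM2r (sumsq_ge0 P l x) _).
    apply: (@le_trans _ _ (\sum_(k < l) alpha (P k) * alpha (P l))).
      by apply: ler_sum => k _; exact: (quotient_coef bP).
    rewrite -mulr_suml mulrC ler_wpM2l//; apply: le_trans (sum_alpha bP).
    by rewrite (big_ord_widen n (fun k => alpha (P k)) (ltnW ln)) big_mkcond/=;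
      apply: ler_sum => k _; case: ifP.
  have h2 : (\sum_(i < m.+1) s i (P l) * x ^+ i) ^+ 2 <= alpha (P l) * X.
    apply: le_trans (cauchy_schwarz_sum _ _) _; apply: ler_pM; last exact: xX.
    - by apply: sumr_ge0 => i _; exact: sqr_ge0.
    - by apply: sumr_ge0 => i _; exact: sqr_ge0.
    - by apply: ler_sum => i _; rewrite lerDl sqr_ge0.
  move: h1 h2; set a := \sum_(k < l) _; set b := \sum_(i < m.+1) _ => h1 h2.
  apply: (@le_trans _ _ (2 * (v.[x] ^+ 2 * a ^+ 2) + 2 * b ^+ 2)).
    by have := sqr_ge0 (v.[x] * a - b); rewrite -exprMn; nra.
  apply: (@le_trans _ _ (2 * (V * (alpha (P l) * B * sumsq P l x))
      + 2 * (alpha (P l) * X))).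
    rewrite lerD// ler_wpM2l//; apply: ler_pM => //; [exact: sqr_ge0..|exact: vV].
  rewrite -subr_ge0.
  have -> : alpha (P l) * L * (1 + sumsq P l x) - (2 * (V * (alpha (P l) * B * sumsq P l x))
      + 2 * (alpha (P l) * X)) =
    2 * V * B * alpha (P l) + 2 * X * alpha (P l) * sumsq P l x by rewrite /L; ring.
  by rewrite addr_ge0// !mulr_ge0.
(* 1 + y <= expR y turns the recursive bound into an exponential one *)
have gronwall k : (k <= n)%N -> 1 + sumsq P k x <= expR (L * \sum_(j < k) alpha (P j)).
  elim: k => [_|k IH kn]; first by rewrite /sumsq !big_ord0 mulr0 expR0 addr0.
  rewrite /sumsq !big_ord_recr/= mulrDr expRD.
  apply: (@le_trans _ _ ((1 + sumsq P k x) * (1 + L * alpha (P k)))).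
    have -> : (1 + sumsq P k x) * (1 + L * alpha (P k)) =
      1 + sumsq P k x + alpha (P k) * L * (1 + sumsq P k x) by ring.
    by rewrite addrA lerD2l step.
  apply: ler_pM; [by rewrite addr_ge0|by rewrite addr_ge0// mulr_ge0|exact: IH (ltnW kn)|].
  exact: expR_ge1Dx.
have pE : p = \sum_(k < n) ip p (P k) *: P k by exact: eP.
have pp : ip p p = \sum_(k < n) ip p (P k) ^+ 2.
  have ip_l0 r : ip 0 r = 0.
    by have := ip_linear (-1) 0 0 r; rewrite scaler0 addr0 mulN1r addNr.
  have key (c : nat -> R) j : ip (\sum_(k < j) c k *: P k) p = \sum_(k < j) c k * ip (P k) p.
    elim: j => [|j IH]; first by rewrite !big_ord0.
    by rewrite !big_ord_recr/= addrC ip_linear IH addrC.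
  rewrite {1}pE (key (fun k => ip p (P k))); apply: eq_bigr => k _.
  by rewrite (ipC (P k)) expr2.
have -> : p.[x] = \sum_(k < n) ip p (P k) * (P k).[x].
  by rewrite {1}pE horner_sum; apply: eq_bigr => k _; rewrite hornerZ.
apply: le_trans (cauchy_schwarz_sum _ _) _.
rewrite -pp mulrC ler_wpM2r//.
  by rewrite pp; apply: sumr_ge0 => k _; exact: sqr_ge0.
apply: (@le_trans _ _ (1 + sumsq P n x)); first by rewrite lerDr.
apply: le_trans (gronwall n (leqnn n)) _.
by rewrite ler_expR ler_wpM2l// sum_alpha.
Qed.

End evaluation.

(** * Rational test functions determine a measure *)

Section rational_test_functions.
Context (R : realType).
Implicit Types (mu nu : borel_measure R) (p w : {poly R}).

Lemma tempered_inv w : (forall t, 1 <= w.[t]) ->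
  tempered (fun t : measurableTypeR R => (w.[t])^-1).
Proof.
move=> w1; split.
  rewrite (_ : (fun _ => _) =
      (fun x : R => x `^ (-1)) \o (fun t : measurableTypeR R => w.[t])).
    apply: measurableT_comp; first exact: measurable_powR.
    exact: (tempered_measurable (tempered_poly w)).
  by apply/funext => t /=; rewrite powR_inv1// (le_trans _ (w1 t)).
exists 1, 0%N => t; rewrite expr0 mulr1 normfV ger0_norm ?(le_trans _ (w1 t))//.
by rewrite invf_le1// (lt_le_trans _ (w1 t)).
Qed.

(** Bernoulli's inequality for the reciprocal [q] of [1 + a]. *)
Lemma natmul_geometric_le1 (a q : R) n : 0 <= a -> 0 <= q -> q * (1 + a) = 1 ->
  (1 + n%:R * a) * q ^+ n <= 1.
Proof.
move=> a0 q0 qa; elim: n => [|n IH]; first by rewrite mul0r addr0 mul1r expr0.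
apply: le_trans IH; rewrite exprS mulrA ler_wpM2r ?exprn_ge0//.
rewrite -natr1; set b := n%:R.
have : 0 <= b * a * a * q by rewrite !mulr_ge0// ler0n.
have -> : (1 + (b + 1) * a) * q = (1 + b * a) * (q * (1 + a)) - b * a * a * q by ring.
by rewrite qa; lra.
Qed.

(** Half of the power beats the factor [n], the other half tends to 0. *)
Lemma natmul_geometric_cvg0 (x : R) : 0 <= x < 1 ->
  (fun n : nat => n%:R * (x ^+ 2) ^+ n) @ \oo --> (0 : R).
Proof.
case/andP => x0; have [->|xn0] := eqVneq x 0 => x1.
  apply: cvg_near_cst; apply/nearW => -[|n]; first by rewrite mul0r.
  by rewrite expr0n/= expr0n/= mulr0.
have xgt0 : 0 < x by rewrite lt0r xn0.
pose a := x^-1 - 1.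
have a0 : 0 < a by rewrite subr_gt0 invf_gt1.
have xa : x * (1 + a) = 1 by rewrite addrC subrK mulfV.
apply: (@squeeze_cvgr _ _ _ _ (fun=> 0) (fun n => a^-1 * x ^+ n)).
- apply/nearW => n; rewrite mulr_ge0 ?exprn_ge0 ?sqr_ge0//=.
  rewrite -exprM mulnC exprM expr2 mulrA ler_wpM2r ?exprn_ge0//.
  rewrite -div1r ler_pdivlMr// mulrAC.
  apply: le_trans (natmul_geometric_le1 n (ltW a0) x0 xa).
  by rewrite ler_wpM2r ?exprn_ge0// lerDr.
- exact: cvg_cst.
- rewrite -[X in _ --> X](mulr0 (a^-1)); apply: cvgM; first exact: cvg_cst.
  by apply: cvg_expr; rewrite ger0_norm.
Qed.

(* The factor n makes 1/bump tend to 0 also on the boundary of the ball, so that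
   the limit is exactly the indicator of the open ball. *)
Let bump (c r : R) n : {poly R} :=
  1 + n%:R *: (((r^-1 *: ('X - c%:P)) ^+ 2) ^+ 2) ^+ n.

Let bumpE c r n t : (bump c r n).[t] = 1 + n%:R * ((((t - c) / r) ^+ 2) ^+ 2) ^+ n.
Proof. by rewrite /bump !hornerE [r^-1 * _]mulrC. Qed.

Let bump_ge1 c r n t : 1 <= (bump c r n).[t].
Proof. by rewrite bumpE lerDl mulr_ge0// exprn_ge0// sqr_ge0. Qed.

Let bump_cvg (c r t : R) : 0 < r ->
  (fun n => ((bump c r n).[t])^-1) @ \oo --> (\1_(ball c r) t : R).
Proof.
move=> r0; under eq_fun do rewrite bumpE.
set x := ((t - c) / r) ^+ 2.
have x0 : 0 <= x by exact: sqr_ge0.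
have -> : (\1_(ball c r) t : R) = (x < 1)%R%:R.
  rewrite indicE.
  have -> : (t \in (ball c r : set R)) = (`|c - t| < r).
    by apply/idP/idP => [/set_mem//|?]; exact/mem_set.
  congr (_%:R : R).
  rewrite /x exprMn exprVn ltr_pdivrMr ?exprn_gt0// mul1r distrC.
  by rewrite -[(t - c) ^+ 2]real_normK ?num_real// ltr_sqr ?nnegrE// ltW.
have [x1|x1] := ltP x 1.
  suff : (fun n : nat => (1 + n%:R * (x ^+ 2) ^+ n)^-1) @ \oo --> (1 : R) by [].
  rewrite -[X in _ --> X]invr1; apply: cvgV; first exact: oner_neq0.
  rewrite -[X in _ --> X]addr0; apply: cvgD; first exact: cvg_cst.
  by apply: natmul_geometric_cvg0; rewrite x0.
suff : (fun n : nat => (1 + n%:R * (x ^+ 2) ^+ n)^-1) @ \oo --> (0 : R) by [].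
apply: (@squeeze_cvgr _ _ _ _ (fun=> 0) (fun n => (n.+1%:R)^-1)).
- apply/nearW => n; have h : n.+1%:R <= 1 + n%:R * (x ^+ 2) ^+ n.
    by rewrite -natr1 addrC lerD2l ler_peMr// exprn_ege1// exprn_ege1.
  rewrite invr_ge0 (le_trans _ h)//= lef_pV2// posrE ?ltr0Sn//; exact: lt_le_trans h.
- exact: cvg_cst.
- exact: cvg_harmonic.
Qed.

Let bump_integral_cvg mu (c r : R) : finite_moments mu -> 0 < r ->
  (fun n => \int[mu]_t ((((bump c r n).[t])^-1)%:E))%E @ \oo --> mu (ball c r).
Proof.
move=> fm r0.
have [] := @dominated_convergence _ (measurableTypeR R) _ mu setT measurableT
  (fun n t => (((bump c r n).[t])^-1)%:E) (fun t => (\1_(ball c r) t)%:E) (cst 1%E).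
- move=> n; apply/measurable_EFinP.
  exact: (tempered_measurable (tempered_inv (bump_ge1 c r n))).
- apply/measurable_EFinP; apply: measurable_indic; exact: measurable_ball.
- apply: aeW => t _; apply: cvg_EFin; first exact: nearW.
  exact: bump_cvg.
- exact: (tempered_integrable fm (tempered_cst 1)).
- apply: aeW => t n _ /=; rewrite lee_fin.
  have h := bump_ge1 c r n t.
  by rewrite ger0_norm ?invr_ge0 ?invf_le1 ?(lt_le_trans _ h)// (le_trans _ h).
move=> _ _; rewrite integral_indic ?setIT//; exact: measurable_ball.
Qed.

(** The reciprocals of the polynomials 1 + n ((t - c) / r)^(4n) tend boundedly
to the indicator of a ball; hence the measures agree on balls, then on
open half-lines, which form a pi-system generating the Borel sets. *)
Lemma eq_measure_rational mu nu : finite_moments mu -> finite_moments nu ->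
  (forall w, (forall t, 1 <= w.[t]) ->
     \int[mu]_t (w.[t])^-1 = \int[nu]_t (w.[t])^-1) ->
  forall A : set (measurableTypeR R), measurable A -> mu A = nu A.
Proof.
move=> fmu fnu H.
have ballE (c r : R) : 0 < r -> mu (ball c r) = nu (ball c r).
  move=> r0; apply: (cvg_unique _ (bump_integral_cvg (c := c) fmu r0)).
    exact: ereal_hausdorff.
  rewrite (_ : (fun _ => _) =
      (fun n => \int[nu]_t ((((bump c r n).[t])^-1)%:E))%E).
    exact: bump_integral_cvg.
  apply/funext => n; rewrite !integral_tempered//; first by rewrite H.
  - exact: tempered_inv.
  - exact: tempered_inv.
have rayE (a : R) : mu `]a, +oo[%classic = nu `]a, +oo[%classic.
  pose F (n : nat) : set (measurableTypeR R) := ball (a + n.+1%:R) n.+1%:R.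
  have FE : `]a, +oo[%classic = \bigcup_n F n.
    apply/seteqP; split => [t /=|t [n _]].
      rewrite in_itv/= andbT => at_.
      exists (Num.truncn (t - a)) => //; rewrite /F /ball/=.
      have := truncnS_gt (t - a); set k := _%:R => tk.
      by rewrite ltr_norml; apply/andP; split; lra.
    rewrite /F /ball/= in_itv/= andbT ltr_norml => /andP[_]; lra.
  have cF m : finite_moments m -> m \o F @ \oo --> m `]a, +oo[%classic.
    move=> fm; rewrite FE; apply: nondecreasing_cvg_mu.
    - by move=> n; exact: measurable_ball.
    - by apply: bigcup_measurable => n _; exact: measurable_ball.
    - move=> i j ij; apply/subsetPset => t; rewrite /F /ball/=.
      have : i.+1%:R <= j.+1%:R :> R by rewrite ler_nat.
      by rewrite !ltr_norml => h /andP[h1 h2]; apply/andP; split; lra.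
  apply: (cvg_unique _ (cF mu fmu)); first exact: ereal_hausdorff.
  rewrite (_ : mu \o F = nu \o F); first exact: cF.
  by apply/funext => n /=; exact: ballE.
apply: (@measure_unique _ _ (measurableTypeR R) (@RGenOInfty.G R)
  (fun n => `]- n%:R, +oo[%classic)).
- exact: RGenOInfty.measurableE.
- move=> _ _ [x ->] [y ->]; exists (Num.max x y).
  apply/seteqP; split => t /=; rewrite !in_itv/= !andbT gt_max.
    by case=> -> ->.
  by case/andP.
- by move=> n; exists (- n%:R).
- apply/seteqP; split => // t _; exists (Num.truncn `|t|).+1 => //=.
  rewrite in_itv/= andbT ltrNl; apply: le_lt_trans (truncnS_gt _).
  by rewrite -normrN ler_norm.
- by move=> _ [x ->]; exact: rayE.
- by move=> n; exact: finite_moments_lty.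
Qed.

End rational_test_functions.

(** * Two measures with the same moments *)

Lemma common_bound (R : realType) (T : Type) n (F : 'I_n -> T -> R) (N : T -> R) :
  (forall p, 0 <= N p) ->
  (forall i, exists2 C, 0 <= C & forall p, F i p <= C * N p) ->
  exists2 C, 0 <= C & forall i p, F i p <= C * N p.
Proof.
move=> N0 H.
have /choice[c hc] : forall i, exists C, 0 <= C /\ forall p, F i p <= C * N p.
  by move=> i; have [C C0 HC] := H i; exists C.
exists (\sum_i c i) => [|i p]; first by apply: sumr_ge0 => i _; case: (hc i).
apply: le_trans (proj2 (hc i) p) _; rewrite ler_wpM2r// (bigD1 i)//= lerDl.
by apply: sumr_ge0 => j _; case: (hc j).
Qed.

Section two_solutions.
Context (R : realType) (mu nu : borel_measure R).
Implicit Types (p q g f v : {poly R}).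
Hypotheses (fmu : finite_moments mu) (fnu : finite_moments nu).
Hypothesis munu : same_moments mu nu.
Variable w : {poly R}.
Hypothesis w_ge1 : forall t, 1 <= w.[t].
Hypothesis mu_neq_nu : \int[mu]_t (w.[t])^-1 <> \int[nu]_t (w.[t])^-1.

Let w_neq0 t : w.[t] != 0.
Proof. by rewrite gt_eqF// (lt_le_trans _ (w_ge1 t)). Qed.

Let l g : R := \int[mu]_t (g.[t] * (w.[t])^-1) - \int[nu]_t (g.[t] * (w.[t])^-1).

Let tempered_polyV g : tempered (fun t : measurableTypeR R => g.[t] * (w.[t])^-1).
Proof. by apply: temperedM; [exact: tempered_poly|exact: tempered_inv]. Qed.

Let Rint_linear m a p q : finite_moments m ->
  \int[m]_t ((a *: p + q).[t] * (w.[t])^-1) =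
  a * \int[m]_t (p.[t] * (w.[t])^-1) + \int[m]_t (q.[t] * (w.[t])^-1).
Proof.
move=> fm; rewrite -Rintegral_temperedZ// -Rintegral_temperedD//.
  by apply: eq_Rintegral => t _; rewrite hornerD hornerZ mulrDl mulrA.
exact: temperedZ.
Qed.

Let l_linear a p q : l (a *: p + q) = a * l p + l q.
Proof. by rewrite /l !Rint_linear//; ring. Qed.

Let l0 : l 0 = 0.
Proof. by have := l_linear (-1) 0 0; rewrite scaler0 addr0 mulN1r addNr. Qed.

Let lD p q : l (p + q) = l p + l q.
Proof. by rewrite -[p]scale1r l_linear mul1r scale1r. Qed.

Let lZ a p : l (a *: p) = a * l p.
Proof. by rewrite -[a *: p]addr0 l_linear l0 addr0. Qed.

Let l_sum I (s : seq I) (F : I -> {poly R}) : l (\sum_(i <- s) F i) = \sum_(i <- s) l (F i).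
Proof. by elim: s => [|i s IH]; rewrite ?big_nil ?l0// !big_cons lD IH. Qed.

(* The largest ideal on which l vanishes; it contains w, but not 1. *)
Let J f := forall g, l (f * g) = 0.

Let Jw : J w.
Proof.
move=> g; rewrite /l.
have E (m : borel_measure R) : \int[m]_t ((w * g).[t] * (w.[t])^-1) = \int[m]_t g.[t].
  by apply: eq_Rintegral => t _; rewrite hornerM mulrAC mulfV ?mul1r.
by rewrite !E (same_moments_poly _ fmu fnu munu) subrr.
Qed.

Let JN1 : ~ J 1.
Proof.
move=> /(_ 1) /eqP; rewrite mulr1 /l subr_eq0 => /eqP; apply: contra_not mu_neq_nu => H.
have E (m : borel_measure R) :
    \int[m]_t ((1 : {poly R}).[t] * (w.[t])^-1) = \int[m]_t (w.[t])^-1.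
  by apply: eq_Rintegral => t _; rewrite hornerE mul1r.
by rewrite -!E.
Qed.

Let modulus_exists : exists v, [/\ (1 < size v)%N, J v & forall f, J f -> v %| f].
Proof.
have w0 : w != 0 by apply/eqP => w0; have := w_neq0 0; rewrite w0 horner0 eqxx.
have ex : exists n, `[< exists f, [/\ f != 0, J f & size f = n] >].
  by exists (size w); apply/asboolP; exists w.
case: (ex_minnP ex) => n /asboolP[v [v0 Jv sv]] vmin.
exists v; split => //.
- rewrite ltn_neqAle lt0n size_poly_eq0 v0 andbT; apply/eqP => /esym/eqP/size_poly1P[c c0 vc].
  apply: JN1 => g; rewrite mul1r.
  have -> : g = v * (c^-1 *: g) by rewrite vc mul_polyC scalerA mulfV// scale1r.
  exact: Jv.
- move=> f Jf; apply: contraT => nvf.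
  have r0 : f %% v != 0 by [].
  have Jr : J (f %% v).
    move=> g; have -> : f %% v = (-1) *: ((f %/ v) * v) + f.
      by rewrite {3}(divp_eq f v) scaleN1r addKr.
    rewrite mulrDl lD -scalerAl lZ Jf addr0 -mulrA mulrCA Jv mulr0//.
  have := vmin (size (f %% v)); rewrite leqNgt -sv ltn_modp v0; apply.
  by apply/asboolP; exists (f %% v).
Qed.

Let bounded_pairing (h : measurableTypeR R -> R) : tempered h ->
  exists2 C, 0 <= C &
    forall p, (\int[nu]_t (p.[t] * h t)) ^+ 2 <= C * \int[nu]_t (p.[t] * p.[t]).
Proof.
move=> th; exists (\int[nu]_t (h t ^+ 2)) => [|p].
  by apply: Rintegral_ge0 => t _; exact: sqr_ge0.
rewrite mulrC; apply: le_trans (cauchy_schwarz_integral fnu (tempered_poly p) th) _.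
by under eq_Rintegral do rewrite expr2.
Qed.

Let bounded_l g : exists2 C, 0 <= C &
  forall p, l (p * g) ^+ 2 <= C * \int[nu]_t (p.[t] * p.[t]).
Proof.
pose h (t : measurableTypeR R) : R := g.[t] * (w.[t])^-1.
have th : tempered h by exact: tempered_polyV.
have A0 : 0 <= \int[mu]_t (h t ^+ 2) by apply: Rintegral_ge0 => t _; exact: sqr_ge0.
have B0 : 0 <= \int[nu]_t (h t ^+ 2) by apply: Rintegral_ge0 => t _; exact: sqr_ge0.
exists (2 * \int[mu]_t (h t ^+ 2) + 2 * \int[nu]_t (h t ^+ 2)) => [|p].
  by rewrite addr_ge0// mulr_ge0.
have E (m : borel_measure R) : \int[m]_t ((p * g).[t] * (w.[t])^-1) = \int[m]_t (p.[t] * h t).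
  by apply: eq_Rintegral => t _; rewrite hornerM mulrA.
have S (m : borel_measure R) : \int[m]_t (p.[t] * p.[t]) = \int[m]_t (p.[t] ^+ 2).
  by apply: eq_Rintegral => t _; rewrite expr2.
have smn : \int[mu]_t (p.[t] ^+ 2) = \int[nu]_t (p.[t] ^+ 2).
  have := same_moments_poly (p ^+ 2) fmu fnu munu.
  by under eq_Rintegral do rewrite hornerE; under [RHS]eq_Rintegral do rewrite hornerE.
rewrite /l !E S.
have := cauchy_schwarz_integral fmu (tempered_poly p) th.
have := cauchy_schwarz_integral fnu (tempered_poly p) th.
rewrite smn; set a := \int[mu]_t _; set b := \int[nu]_t _ => ha hb.
by have := sqr_ge0 (a + b); nra.
Qed.

(** The generator [v] of the ideal [J] divides [w], so it has no real root and
1/v is tempered.  The matrix of the form (f, g) |-> l (f * g) on the polynomials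
modulo [v] is invertible, which bounds remainders modulo [v] by integrals against
tempered functions, hence by the L^2 norm.  The same bound makes the scalar
product definite: a polynomial of norm 0 is divisible by [v], with a quotient of
norm 0 and of smaller degree. *)
Lemma evaluation_bounded_of_two_solutions M : exists2 K, 0 <= K &
  forall x, `|x| <= M -> forall p, p.[x] ^+ 2 <= K * \int[nu]_t (p.[t] ^+ 2).
Proof.
have [v [v1 Jv dvdv]] := modulus_exists.
have [m vm] : exists m, size v = m.+2.
  by case: (size v) v1 => [|[|m]]// _; exists m.
have v0 : v != 0 by rewrite -size_poly_eq0 vm.
pose u := w %/ v.
have wuv : w = u * v by rewrite divpK// dvdv.
pose iv (t : measurableTypeR R) : R := u.[t] * (w.[t])^-1.
have tiv : tempered iv by exact: tempered_polyV.
have viv t : v.[t] * iv t = 1.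
  by rewrite /iv mulrA [v.[t] * _]mulrC -hornerM -wuv mulfV.
pose ip p q := \int[nu]_t (p.[t] * q.[t]).
have tpp p q : tempered (fun t : measurableTypeR R => p.[t] * q.[t]).
  by apply: temperedM; exact: tempered_poly.
have ipC p q : ip p q = ip q p.
  by apply: eq_Rintegral => t _; rewrite mulrC.
have ip_ge0 p : 0 <= ip p p by apply: Rintegral_ge0 => t _; rewrite -expr2 sqr_ge0.
have ip_linear a p q r : ip (a *: p + q) r = a * ip p r + ip q r.
  rewrite /ip -Rintegral_temperedZ// -Rintegral_temperedD//; last exact: temperedZ.
  by apply: eq_Rintegral => t _; rewrite hornerD hornerZ mulrDl mulrA.
pose s (i : 'I_m.+1) p := (p %% v)`_i.
have modE p : p %% v = \sum_(i < m.+1) s i p *: 'X^i.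
  rewrite -[LHS]coefK poly_def.
  have sv : (size (p %% v)%R <= m.+1)%N by have := ltn_modp p v; rewrite v0 vm ltnS.
  rewrite (big_ord_widen _ (fun i => (p %% v)`_i *: 'X^i) sv) big_mkcond/=.
  apply: eq_bigr => i _; case: ltnP => // h; by rewrite /s nth_default// scale0r.
pose G : 'M[R]_m.+1 := \matrix_(i, j) l ('X^i * 'X^j).
have lG (c : 'I_m.+1 -> R) (j : 'I_m.+1) :
    l ((\sum_(i < m.+1) c i *: 'X^i) * 'X^j) = ((\row_i c i) *m G) 0 j.
  rewrite mulr_suml l_sum mxE; apply: eq_bigr => i _.
  by rewrite -scalerAl lZ !mxE.
have lmod p g : l (p * g) = l ((p %% v) * g).
  rewrite {1}(divp_eq p v) mulrDl lD -mulrA mulrCA Jv add0r//.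
have Gu : G \in unitmx.
  rewrite -row_free_unit; apply: inj_row_free => y yG.
  pose f := \sum_(i < m.+1) y 0 i *: 'X^i.
  have Jf : J f.
    move=> g; rewrite mulrC lmod mulrC modE mulr_sumr l_sum big1// => j _.
    rewrite -scalerAr lZ /f lG.
    have -> : \row_i y 0 i = y by apply/rowP => i; rewrite mxE.
    by rewrite yG mxE mulr0.
  have sf : (size f <= m.+1)%N.
    apply: leq_trans (size_sum _ _ _) _; apply/bigmax_leqP => i _.
    by rewrite (leq_trans (size_scale_leq _ _))// size_polyXn.
  have f0 : f = 0.
    apply/eqP; apply: contraTT (dvdv _ Jf) => f0.
    by apply/negP => /(dvdp_leq f0); rewrite vm ltnNge sf.
  apply/rowP => j; rewrite mxE.
  have := congr1 (fun q : {poly R} => q`_j) f0; rewrite coef0 coef_sum (bigD1 j)//=.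
  rewrite coefZ coefXn eqxx mulr1 big1 ?addr0// => i ij.
  by rewrite coefZ coefXn (inj_eq val_inj) eq_sym (negbTE ij) mulr0.
have sE i p : s i p = \sum_(j < m.+1) l (p * 'X^j) * (invmx G) j i.
  have : (\row_i s i p) *m G = \row_(j < m.+1) l (p * 'X^j).
    by apply/rowP => j; rewrite [RHS]mxE lmod [in RHS]modE lG.
  move=> /(congr1 (fun A => A *m invmx G)); rewrite mulmxK// => /rowP/(_ i).
  by rewrite !mxE => ->; apply: eq_bigr => j _; rewrite mxE.
have [D D0 hD] : exists2 D, 0 <= D & forall (j : 'I_m.+1) p, l (p * 'X^j) ^+ 2 <= D * ip p p.
  by apply: common_bound => // j; exact: bounded_l.
have [C1 C10 hC1] : exists2 C, 0 <= C & forall (i : 'I_m.+1) p, s i p ^+ 2 <= C * ip p p.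
  apply: common_bound => // i.
  exists ((\sum_(j < m.+1) D) * \sum_j (invmx G) j i ^+ 2) => [|p].
    by rewrite mulr_ge0// sumr_ge0// => j _; exact: sqr_ge0.
  rewrite sE; apply: le_trans (cauchy_schwarz_sum _ _) _.
  rewrite mulrAC ler_wpM2r//; first by apply: sumr_ge0 => j _; exact: sqr_ge0.
  by rewrite mulr_suml; apply: ler_sum => j _.
pose U (i : 'I_m.+1) p := \int[nu]_t (p.[t] * (t ^+ i * iv t)).
have tU (i : 'I_m.+1) : tempered (fun t : measurableTypeR R => t ^+ i * iv t).
  by apply: temperedM => //; exact: tempered_pow.
have tUp (i : 'I_m.+1) p : tempered (fun t : measurableTypeR R => p.[t] * (t ^+ i * iv t)).
  by apply: temperedM => //; exact: tempered_poly.
have [C2 C20 hC2] : exists2 C, 0 <= C & forall i p, U i p ^+ 2 <= C * ip p p.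
  by apply: common_bound => // i; exact: bounded_pairing.
have U_linear i a p q : U i (a *: p + q) = a * U i p + U i q.
  rewrite /U -Rintegral_temperedZ// -Rintegral_temperedD//; last exact: temperedZ.
  by apply: eq_Rintegral => t _; rewrite hornerD hornerZ mulrDl -mulrA.
(* both sides of the skew-symmetry relation equal the integral of p q / v *)
have skewE p q : ip (p %/ v) q + \sum_i s i p * U i q = \int[nu]_t (p.[t] * q.[t] * iv t).
  have tsum : tempered (fun t : measurableTypeR R => \sum_i s i p * (q.[t] * (t ^+ i * iv t))).
    by apply: tempered_sum => i; exact: temperedZ.
  have -> : \sum_i s i p * U i q = \int[nu]_t (\sum_i s i p * (q.[t] * (t ^+ i * iv t))).
    rewrite Rintegral_tempered_sum//; last by move=> i; exact: temperedZ.
    by apply: eq_bigr => i _; rewrite Rintegral_temperedZ.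
  rewrite /ip -Rintegral_temperedD//; apply: eq_Rintegral => t _.
  have -> : p.[t] = (p %/ v).[t] * v.[t] + \sum_i s i p * t ^+ i.
    rewrite {1}(divp_eq p v) hornerD hornerM modE horner_sum; congr (_ + _).
    by apply: eq_bigr => i _; rewrite hornerZ hornerXn.
  rewrite 2!mulrDl; congr (_ + _); first by rewrite -[in RHS]mulrA mulrACA viv mulr1.
  by rewrite !mulr_suml; apply: eq_bigr => i _; ring.
have ip_gt0 p : p != 0 -> 0 < ip p p.
  move: {2}(size p) (leqnn (size p)) => n; elim: n p => [|n IH] p.
    by rewrite leqn0 size_poly_eq0 => ->.
  move=> pn p0; rewrite lt0r ip_ge0 andbT; apply/eqP => pp0.
  have r0 : p %% v = 0.
    rewrite modE big1// => i _; have := hC1 i p; rewrite pp0 mulr0 => h.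
    suff -> : s i p = 0 by rewrite scale0r.
    by apply/eqP; rewrite -sqrf_eq0 eq_le h sqr_ge0.
  have pE : p = (p %/ v) * v by rewrite {1}(divp_eq p v) r0 addr0.
  have q0 : p %/ v != 0 by apply: contra_neq p0 => q0; rewrite pE q0 mul0r.
  have qn : (size (p %/ v)%R <= n)%N.
    rewrite size_divp// vm /= leq_subLR (leq_trans pn)// addSn ltnS leq_addl//.
  have := IH _ qn q0; rewrite ltNge => /negP; apply.
  have tq : tempered (fun t : measurableTypeR R => (p %/ v).[t] * iv t).
    by apply: temperedM => //; exact: tempered_poly.
  have [E E0 hE] := bounded_pairing tq.
  have := hE p; rewrite -/(ip p p) pp0 mulr0.
  have -> : \int[nu]_t (p.[t] * ((p %/ v).[t] * iv t)) = ip (p %/ v) (p %/ v).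
    by apply: eq_Rintegral => t _; rewrite {1}pE hornerM mulrACA viv mulr1.
  by have := ip_ge0 (p %/ v); nra.
have UC i p : U i p ^+ 2 <= (C1 + C2) * ip p p.
  by apply: le_trans (hC2 i p) _; rewrite ler_wpM2r// lerDr.
have sC i p : s i p ^+ 2 <= (C1 + C2) * ip p p.
  by apply: le_trans (hC1 i p) _; rewrite ler_wpM2r// lerDl.
have skew p q : ip (p %/ v) q + \sum_i s i p * U i q =
    ip p (q %/ v) + \sum_i s i q * U i p.
  rewrite skewE [ip p _]ipC skewE; apply: eq_Rintegral => t _.
  by rewrite [p.[t] * _]mulrC.
have [K K0 hK] := evaluation_bounded ipC ip_linear ip_gt0 vm U_linear UC sC skew M.
by exists K.
Qed.

End two_solutions.

Lemma evaluation_bounded_of_indeterminate (R : realType) (nu : borel_measure R) M :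
  H_indeterminate nu -> exists2 K, 0 <= K &
  forall x, `|x| <= M -> forall p : {poly R}, p.[x] ^+ 2 <= K * \int[nu]_t (p.[t] ^+ 2).
Proof.
move=> [fnu]; apply: contra_notP => noK; split => // mu fmu munu.
apply: eq_measure_rational => // w w1; apply: contra_notP noK => neq.
exact: (evaluation_bounded_of_two_solutions fmu fnu munu w1 neq).
Qed.

(** * Discreteness of N-extremal measures *)

Section N_extremal.
Context (R : realType).
Implicit Types (nu : borel_measure R) (p q : {poly R}).

(** Real and imaginary parts of a complex polynomial on the real line; this
carries density of the complex polynomials over to the real ones. *)
Lemma real_imaginary_poly (P : {poly R[i]}) : exists q1 q2 : {poly R},
  forall t : R, P.[t%:C%C] = (q1.[t] +i* q2.[t])%C.
Proof.
elim/poly_ind: P => [|P [a b] [q1 [q2 IH]]].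
  by exists 0, 0 => t; rewrite !horner0.
exists (q1 * 'X + a%:P), (q2 * 'X + b%:P) => t.
rewrite !hornerMXaddC IH; simpc; congr (_ +i* _)%C; ring.
Qed.

Lemma indicator_approximation nu (A : set (measurableTypeR R)) (e : R) :
  N_extremal nu -> measurable A -> 0 < e ->
  exists q, \int[nu]_t ((q.[t] - \1_A t) ^+ 2) < e.
Proof.
move=> [[fnu _] dnu] mA e0.
pose f (t : R) : R[i] := ((\1_A t : R)%:C)%C.
have tA : tempered (\1_A : measurableTypeR R -> R) by exact: tempered_indic.
have norm2E (g : R -> R[i]) (a b : measurableTypeR R -> R) : tempered a -> tempered b ->
    (forall t, g t = (a t +i* b t)%C) ->
    (('N[nu]_2%:E [(fun t => (Normc.normc (g t))%:E)]) `^ 2 =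
      (\int[nu]_t (a t ^+ 2 + b t ^+ 2))%R%:E)%E.
  move=> ta tb gE; rewrite poweR_Lnorm// -integral_tempered//; last first.
    by apply: temperedD; exact: temperedX.
  apply: eq_integral => t _.
  have n0 : 0 <= Normc.normc (g t) by rewrite gE /= sqrtr_ge0.
  rewrite /= ger0_norm// powR_mulrn// gE/= sqr_sqrtr//.
  by rewrite addr_ge0// sqr_ge0.
have Lf : complex_L2 nu f.
  split.
  - exact: (tempered_measurable tA).
  - exact: measurable_cst.
  - have h := norm2E f _ _ tA (tempered_cst 0) (fun t => erefl).
    by rewrite ltey; apply/eqP => Noo; move: h; rewrite Noo poweRyr.
have se : 0 < Num.sqrt e by rewrite sqrtr_gt0.
have [P hP] := dnu f Lf _ se.
have [q1 [q2 Pq]] := real_imaginary_poly P.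
exists q1.
have ta : tempered (fun t : measurableTypeR R => \1_A t - q1.[t]).
  by apply: temperedB => //; exact: tempered_poly.
have tb : tempered (fun t : measurableTypeR R => - q2.[t]).
  by apply: temperedN; exact: tempered_poly.
have := norm2E (fun t => f t - P.[t%:C%C]) _ _ ta tb.
move: hP; have := Lnorm_ge0 nu 2%:E (fun t => (Normc.normc (f t - P.[t%:C%C]))%:E).
case: ('N[nu]_2%:E [_])%E => [n| |]//; rewrite lee_fin lte_fin => n0 ns.
have fP t : f t - P.[t%:C%C] = ((\1_A t - q1.[t]) +i* (- q2.[t]))%C.
  by rewrite Pq /f; simpc.
move=> /(_ fP); rewrite poweR_EFin powR_mulrn// => -[n2].
apply: le_lt_trans (_ : n ^+ 2 < e); last first.
  by rewrite -[ltRHS]sqr_sqrtr ?ltW// ltr_sqr ?nnegrE// ltW.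
rewrite n2; apply: le_Rintegral_tempered => //.
- by apply: temperedX; apply: temperedB => //; exact: tempered_poly.
- by apply: temperedD; exact: temperedX.
- move=> t; rewrite -[(q1.[t] - _) ^+ 2]sqrrN opprB lerDl sqr_ge0//.
Qed.

(** A polynomial [q] close to the indicator of [A] has squared norm close to
[nu A], so q^2 is at most about [K * nu A] on [A]; as [q] is close to 1 there
in the mean, [nu A] is at most a constant times [K * (nu A) ^ 2]. *)
Lemma small_sets_null nu M : N_extremal nu -> exists2 K, 0 <= K &
  forall A : set (measurableTypeR R), measurable A -> (forall x, A x -> `|x| <= M) ->
    nu A = 0%E \/ 1 <= K * fine (nu A).
Proof.
move=> Nnu; have [[fnu _] _] := Nnu.
have [K K0 hK] := evaluation_bounded_of_indeterminate M (proj1 Nnu).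
exists (4 * K) => [|A mA AM]; first by rewrite mulr_ge0.
have Afin : nu A \is a fin_num by rewrite ge0_fin_numE// finite_moments_lty.
set a := fine (nu A).
have [a0|an0] := eqVneq a 0; [left|right].
  by rewrite -(fineK Afin) -/a a0.
have agt0 : 0 < a by rewrite lt0r an0 fine_ge0.
have tA : tempered (\1_A : measurableTypeR R -> R) by exact: tempered_indic.
have key e : 0 < e -> a <= 2 * K * (2 * a + 2 * e) * a + 2 * e.
  move=> e0; have [q qe] := indicator_approximation Nnu mA e0.
  have tq := tempered_poly q.
  have td : tempered (fun t : measurableTypeR R => (q.[t] - \1_A t) ^+ 2).
    by apply: temperedX; exact: temperedB.
  have tq2 := temperedX 2 tq.
  set N := \int[nu]_t (q.[t] ^+ 2) in hK *.
  have aE : a = \int[nu]_t \1_A t by rewrite Rintegral_indic.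
  have Na : N <= 2 * a + 2 * e.
    apply: (@le_trans _ _ (\int[nu]_t (2 * \1_A t + 2 * (q.[t] - \1_A t) ^+ 2))).
      apply: le_Rintegral_tempered => //; first by apply: temperedD; exact: temperedZ.
      move=> t; rewrite indicE; case: (_ \in _); last by rewrite /=; nra.
      by have := sqr_ge0 (q.[t] - 2); rewrite /=; nra.
    rewrite Rintegral_temperedD ?Rintegral_temperedZ//; try exact: temperedZ.
    by rewrite aE; lra.
  have aN : a <= 2 * (K * N) * a + 2 * e.
    apply: (@le_trans _ _ (\int[nu]_t (2 * (K * N) * \1_A t + 2 * (q.[t] - \1_A t) ^+ 2))).
      rewrite aE; apply: le_Rintegral_tempered => //.
        by apply: temperedD; exact: temperedZ.
      move=> t; rewrite indicE; case: (boolP (_ \in _)) => [/set_mem At|_].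
        have := hK t (AM t At) q; rewrite -/N /=.
        by have := sqr_ge0 (2 * q.[t] - 1); rewrite /=; nra.
      by rewrite /= mulr0 add0r mulr_ge0// sqr_ge0.
    rewrite Rintegral_temperedD ?Rintegral_temperedZ//; try exact: temperedZ.
    by rewrite -aE; lra.
  apply: le_trans aN _; rewrite lerD2r (ler_wpM2r (ltW agt0))//.
  by move: (ler_wpM2l K0 Na); nra.
rewrite leNgt; apply/negP => Ka.
pose D := 4 * K * a + 2.
have D0 : 0 < D by rewrite ltr_wpDl// !mulr_ge0// ltW.
pose e := a * (1 - 4 * K * a) / (2 * D).
have e0 : 0 < e by rewrite divr_gt0// ?mulr_gt0// subr_gt0.
have := key e e0.
have eD : e * D = a * (1 - 4 * K * a) / 2 by rewrite /e; field; rewrite gt_eqF.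
have : 0 < a * (1 - 4 * K * a) by rewrite mulr_gt0// subr_gt0.
rewrite /D in eD.
by nra.
Qed.

(** The punctured balls around [x] decrease to the empty set, so their masses tend
to 0 and, by the dichotomy for small sets, eventually vanish. *)
Lemma supp_isolated nu x : N_extremal nu -> supp nu x ->
  (0 < nu [set x])%E /\ exists2 e : R, 0 < e & forall y, supp nu y -> y != x -> e <= `|y - x|.
Proof.
move=> Nnu sx; have [[fnu _] _] := Nnu.
have [K K0 hK] := small_sets_null (`|x| + 1) Nnu.
pose A (n : nat) : set (measurableTypeR R) := ball x n.+1%:R^-1 `\ x.
have mx : measurable ([set x] : set (measurableTypeR R)) by exact: measurable_set1.
have mA n : measurable (A n) by apply: measurableD => //; exact: measurable_ball.
have AM n y : A n y -> `|y| <= `|x| + 1.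
  move=> [/=]; rewrite /ball/= => xy _.
  have : n.+1%:R^-1 <= 1 :> R by rewrite invf_le1 ?ler1n.
  have := ler_normD x (y - x); rewrite (addrC x) subrK distrC => h1 h2.
  by apply: le_trans h1 _; rewrite lerD2l; exact: le_trans (ltW xy) h2.
have A0 : \bigcap_n A n = set0.
  rewrite -subset0 => y yA; have [_ /= yx] := yA 0%N I.
  have d0 : 0 < `|x - y| by rewrite normr_gt0 subr_eq0 eq_sym; apply/eqP.
  have [xy _] := yA (Num.truncn (`|x - y|^-1)) I.
  move: xy; rewrite /ball/= ltNge => /negP; apply.
  by rewrite -[leRHS]invrK lef_pV2 ?posrE ?invr_gt0// ltW// truncnS_gt.
have cA : (nu \o A) @ \oo --> 0%E.
  rewrite -(measure0 nu) -A0; apply: nonincreasing_cvg_mu => //.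
  - exact: finite_moments_lty.
  - by rewrite A0; exact: measurable0.
  - move=> i j ij; apply/subsetPset => y [xy yx]; split => //.
    by apply: le_ball xy; rewrite lef_pV2 ?posrE// ler_nat.
have [n nuA0] : exists n, nu (A n) = 0%E.
  have fA : (fine \o (nu \o A)) @ \oo --> (0 : R) by exact: fine_cvg.
  have K1 : 0 < (K + 1)^-1 by rewrite invr_gt0 ltr_wpDl.
  move/cvgrPdist_lt: fA => /(_ _ K1)[n _ /(_ n (leqnn n)) /= hn].
  exists n; have [//|h] := hK (A n) (mA n) (AM n).
  move: hn; rewrite sub0r normrN ger0_norm ?fine_ge0// => hn.
  exfalso; move: h; rewrite leNgt => /negP; apply.
  apply: (@le_lt_trans _ _ (K * (K + 1)^-1)); first by rewrite ler_wpM2l// ltW.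
  by rewrite ltr_pdivrMr ?mul1r ?ltrDl// ltr_wpDl.
have r0 : 0 < n.+1%:R^-1 :> R by rewrite invr_gt0.
split.
  have := sx _ (ball_open _ _) (ballxx x r0).
  have -> : ball x n.+1%:R^-1 = [set x] `|` A n.
    by rewrite /A setDUK// => y ->; exact: ballxx.
  move=> h; apply: lt_le_trans h _.
  by rewrite -[leRHS]adde0 -nuA0; exact: measureU2.
exists n.+1%:R^-1 => // y sy yx; rewrite leNgt; apply/negP => xy.
have : (0 < nu (A n))%E.
  apply: sy; last by split; [rewrite /ball/= distrC|apply/eqP].
  apply: openI; first exact: ball_open.
  by rewrite openC; exact: (accessible_closed_set1 (hausdorff_accessible (@Rhausdorff R))).
by rewrite nuA0 ltxx.
Qed.

End N_extremal.

(** * A criterion of determinacy *)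

Lemma le_measure_countable d (T : measurableType d) (R : realType)
    (m1 m2 : {measure set T -> \bar R}) (D : set T) :
  (forall x : T, measurable [set x]) -> countable D ->
  (forall x, D x -> (m1 [set x] <= m2 [set x])%E) -> (m1 D <= m2 D)%E.
Proof.
move=> m1x /countable_injP[f finj] m12.
pose F n := D `&` f @^-1` [set n].
have FE n : F n = set0 \/ exists2 x, D x & F n = [set x].
  have [->|/set0P[x [Dx fx]]] := eqVneq (F n) set0; [by left|right].
  exists x => //; apply/seteqP; split => [y [Dy fy]|_ ->]; last by split.
  by apply: finj; rewrite ?inE//= fx fy.
have mF n : measurable (F n) by case: (FE n) => [->|[x _ ->]].
have tF : trivIset setT F.
  by move=> i j _ _ [x [[_ <-] [_ <-]]].
have -> : D = \bigcup_n F n.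
  by apply/seteqP; split => [x Dx|x [n _ []]//]; exists (f x).
rewrite !measure_bigcup//; apply: lee_nneseries => n _ //.
by case: (FE n) => [->|[x Dx ->]]; [rewrite !measure0|exact: m12].
Qed.

Section determinacy_criterion.
Context (R : realType).
Implicit Types (mu sigma : borel_measure R) (p : {poly R}).

(** Let h = p - 1_l.  Integrate, with respect to [sigma] and to [mu] respectively,
1_l - d - (1/d + 1) h^2 <= 2 p - p^2 and
2 p - p^2 <= 1_(ball l r) + d + (t - l)^2 p^2 / (d r^2);
the integral of 2 p - p^2 is the same for both measures, and so is that of
(t - l)^2 p^2, which is at most a constant times h^2 (1 + t^2).  Letting first h, then d, then r tend to 0 gives the claim. *)
Lemma atom_le_of_approximation sigma mu (l : R) :
  finite_moments sigma -> finite_moments mu -> same_moments mu sigma ->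
  (forall e, 0 < e -> exists p,
     \int[sigma]_t ((p.[t] - \1_[set l] t) ^+ 2 * (1 + t ^+ 2)) < e) ->
  (sigma [set l] <= mu [set l])%E.
Proof.
move=> fs fm sm H.
have ml : measurable ([set l] : set (measurableTypeR R)) by exact: measurable_set1.
have tl : tempered (\1_[set l] : measurableTypeR R -> R) by exact: tempered_indic.
set a := fine (sigma [set l]).
have sE : sigma [set l] = a%:E by rewrite fineK// ge0_fin_numE// finite_moments_lty.
set s := fine (sigma setT).
have s0 : 0 <= s by exact: fine_ge0.
have s1 : \int[sigma]_t (cst 1 t) = s by rewrite Rintegral_cst// mul1r.
have m1 : \int[mu]_t (cst 1 t) = s.
  have := same_moments_poly 1 fm fs sm; rewrite -s1.
  under eq_Rintegral do rewrite hornerE.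
  by under [RHS]eq_Rintegral do rewrite hornerE.
have t1 : tempered (cst 1 : measurableTypeR R -> R) by exact: tempered_cst.
have ball_le (r : R) : 0 < r -> a <= fine (mu (ball l r)).
  move=> r0; rewrite leNgt; apply/negP.
  set b := fine (mu (ball l r)) => ba.
  have mB : measurable (ball l r : set (measurableTypeR R)) by exact: measurable_ball.
  have tB : tempered (\1_(ball l r) : measurableTypeR R -> R) by exact: tempered_indic.
  pose g := a - b; have g0 : 0 < g by rewrite subr_gt0.
  pose d := g / (4 * s + 1).
  have s41 : 0 < 4 * s + 1 by rewrite ltr_wpDl// mulr_ge0.
  have d0 : 0 < d by rewrite divr_gt0.
  have dE : d * (4 * s + 1) = g by rewrite mulfVK// gt_eqF.
  pose c := (d^-1 + 1) + (d * r ^+ 2)^-1 * (2 * (1 + l ^+ 2)).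
  have dr0 : 0 < (d * r ^+ 2)^-1 by rewrite invr_gt0 mulr_gt0// exprn_gt0.
  have l21 : 0 < 1 + l ^+ 2 by rewrite ltr_wpDr// sqr_ge0.
  have dV0 : 0 < d^-1 by rewrite invr_gt0.
  have dV1 : 0 < d^-1 + 1 by exact: addr_gt0.
  have c0 : 0 < c by rewrite addr_gt0// mulr_gt0// mulr_gt0.
  pose e := g / 2 / c.
  have e0 : 0 < e by rewrite !divr_gt0.
  have ec : e * c = g / 2 by rewrite mulfVK// gt_eqF.
  have [p hp] := H e e0.
  pose h (t : measurableTypeR R) : R := (p.[t] - \1_[set l] t) ^+ 2 * (1 + t ^+ 2).
  have th : tempered h.
    apply: temperedM; first by apply: temperedX; apply: temperedB => //; exact: tempered_poly.
    by apply: temperedD => //; exact: tempered_pow.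
  pose f := 2 *: p - p ^+ 2.
  pose k := ('X - l%:P) ^+ 2 * p ^+ 2.
  have fE t : f.[t] = 2 * p.[t] - p.[t] ^+ 2 by rewrite /f !hornerE.
  have kE t : k.[t] = (t - l) ^+ 2 * p.[t] ^+ 2 by rewrite /k !hornerE.
  have tf := tempered_poly f; have tk := tempered_poly k.
  have lower : a - d * s - (d^-1 + 1) * e <= \int[sigma]_t f.[t].
    apply: (@le_trans _ _ (\int[sigma]_t (\1_[set l] t - d * cst 1 t - (d^-1 + 1) * h t))).
      rewrite Rintegral_temperedB//; [|exact/temperedB/temperedZ|exact: temperedZ].
      rewrite Rintegral_temperedB//; last exact: temperedZ.
      rewrite !Rintegral_temperedZ// s1 Rintegral_indic// -/a lerD2l lerN2.
      by rewrite ler_pM2l// ltW.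
    apply: le_Rintegral_tempered => //.
      by apply: temperedB; [apply: temperedB => //|]; exact: temperedZ.
    move=> t; rewrite fE /h /=.
    set x := p.[t] - _.
    have xh : x ^+ 2 <= x ^+ 2 * (1 + t ^+ 2) by rewrite ler_peMr ?sqr_ge0// lerDl sqr_ge0.
    have dx : 0 <= d + 2 * x + d^-1 * x ^+ 2.
      have -> : d + 2 * x + d^-1 * x ^+ 2 = d^-1 * (x + d) ^+ 2 by field; rewrite gt_eqF.
      by rewrite mulr_ge0 ?sqr_ge0 ?invr_ge0// ltW.
    apply: (@le_trans _ _ (\1_[set l] t - d * 1 - (d^-1 + 1) * x ^+ 2)).
      by rewrite lerD2l lerN2 ler_pM2l.
    have -> : p.[t] = x + \1_[set l] t by rewrite subrK.
    by rewrite indicE; case: (_ \in _); rewrite /= ?mulr1n ?mulr0n; nra.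
  have upper : \int[mu]_t f.[t] <= b + d * s + (d * r ^+ 2)^-1 * (2 * (1 + l ^+ 2) * e).
    apply: (@le_trans _ _ (b + d * s + (d * r ^+ 2)^-1 * \int[mu]_t k.[t])); last first.
      rewrite lerD2l ler_pM2l// (same_moments_poly k fm fs sm).
      apply: (@le_trans _ _ (\int[sigma]_t (2 * (1 + l ^+ 2) * h t))); last first.
        by rewrite Rintegral_temperedZ// ler_pM2l ?mulr_gt0// ltW.
      apply: le_Rintegral_tempered => //; first exact: temperedZ.
      move=> t; rewrite kE /h indicE; case: (boolP (_ \in _)) => [/set_mem ->|_].
        rewrite subrr expr0n/= mul0r; apply: mulr_ge0; first by rewrite ltW// mulr_gt0.
        by apply: mulr_ge0; [exact: sqr_ge0|exact: ltW].
      rewrite /= subr0.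
      have -> : 2 * (1 + l ^+ 2) * (p.[t] ^+ 2 * (1 + t ^+ 2)) =
        2 * (1 + l ^+ 2) * (1 + t ^+ 2) * p.[t] ^+ 2 by ring.
      rewrite ler_wpM2r ?sqr_ge0//.
      have : 0 <= t ^+ 2 * l ^+ 2 by rewrite mulr_ge0// sqr_ge0.
      have := sqr_ge0 (t + l); nra.
    have -> : b + d * s + (d * r ^+ 2)^-1 * \int[mu]_t k.[t] =
        \int[mu]_t (\1_(ball l r) t + d * cst 1 t + (d * r ^+ 2)^-1 * k.[t]).
      rewrite Rintegral_temperedD//; [|exact/temperedD/temperedZ|exact: temperedZ].
      rewrite Rintegral_temperedD//; last exact: temperedZ.
      by rewrite !Rintegral_temperedZ// m1 Rintegral_indic.
    apply: le_Rintegral_tempered => //.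
      by apply: temperedD; [apply: temperedD => //|]; exact: temperedZ.
    move=> t; rewrite fE kE indicE /=; case: (boolP (_ \in _)) => [_|/negP tB'].
      rewrite mulr1n mulr1 -addrA ler_wpDr//.
        apply: addr_ge0; first exact: ltW.
        by apply: mulr_ge0; [exact: ltW|apply: mulr_ge0; exact: sqr_ge0].
      have := sqr_ge0 (p.[t] - 1); nra.
    rewrite mulr0n add0r mulr1.
    have rt : r ^+ 2 <= (t - l) ^+ 2.
      rewrite -[leRHS]real_normK ?num_real// ler_sqr ?nnegrE ?(ltW r0)//.
      by rewrite leNgt distrC; apply/negP => ?; apply: tB'; exact/mem_set.
    apply: (@le_trans _ _ (d + d^-1 * p.[t] ^+ 2)).
      have : 0 <= d^-1 * (p.[t] - d) ^+ 2 by rewrite mulr_ge0 ?sqr_ge0 ?invr_ge0// ltW.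
      have -> : d^-1 * (p.[t] - d) ^+ 2 = d + d^-1 * p.[t] ^+ 2 - 2 * p.[t].
        by field; rewrite gt_eqF.
      by have := sqr_ge0 p.[t]; nra.
    have -> : (d * r ^+ 2)^-1 * ((t - l) ^+ 2 * p.[t] ^+ 2) =
      d^-1 * ((t - l) ^+ 2 / r ^+ 2) * p.[t] ^+ 2 by rewrite invfM; ring.
    rewrite lerD2l ler_wpM2r ?sqr_ge0// ler_peMr ?invr_ge0 ?(ltW d0)//.
    by rewrite ler_pdivlMr ?exprn_gt0// mul1r.
  have := le_trans lower; rewrite -(same_moments_poly f fm fs sm) => /(_ _ upper).
  have : (d^-1 + 1) * e + (d * r ^+ 2)^-1 * (2 * (1 + l ^+ 2) * e) = g / 2.
    by rewrite -ec /c; ring.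
  have : d * s < g / 4 by rewrite -dE; have := d0; nra.
  rewrite /g; lra.
pose A n : set (measurableTypeR R) := ball l n.+1%:R^-1.
have mA n : measurable (A n) by exact: measurable_ball.
have lA : [set l] = \bigcap_n A n.
  apply/seteqP; split => [_ -> n _|y yA]; first by apply: ballxx; rewrite invr_gt0.
  apply/eqP; apply: contraT => yl.
  have d0 : 0 < `|l - y| by rewrite normr_gt0 subr_eq0 eq_sym.
  have := yA (Num.truncn (`|l - y|^-1)) I.
  rewrite /A /ball/= ltNge => /negP; case.
  by rewrite -[leRHS]invrK lef_pV2 ?posrE ?invr_gt0// ltW// truncnS_gt.
have cA : (mu \o A) @ \oo --> mu [set l].
  rewrite lA; apply: nonincreasing_cvg_mu => //.
  - exact: finite_moments_lty.
  - by rewrite -lA.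
  - move=> i j ij; apply/subsetPset => y.
    by apply: le_ball; rewrite lef_pV2 ?posrE// ler_nat.
rewrite -(cvg_lim _ cA)//; apply: lime_ge; first by apply/cvg_ex; eexists; exact: cA.
apply: nearW => n /=; rewrite sE -[leRHS]fineK; last first.
  by rewrite ge0_fin_numE// finite_moments_lty.
by rewrite lee_fin; apply: ball_le; rewrite invr_gt0.
Qed.

(** The measure [mu] dominates [sigma] on atoms, hence on all Borel sets since
[sigma] is carried by [S]; applied to complements, equality of the total masses
gives the reverse inequality. *)
Lemma determinate_of_approximation sigma (S : set R) :
  finite_moments sigma -> countable S -> sigma (~` S) = 0%E ->
  (forall l, S l -> forall e, 0 < e -> exists p,
     \int[sigma]_t ((p.[t] - \1_[set l] t) ^+ 2 * (1 + t ^+ 2)) < e) ->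
  H_determinate sigma.
Proof.
move=> fs cS sS H; split => // mu fm sm.
have m1 (x : measurableTypeR R) : measurable [set x] by exact: measurable_set1.
have mS : measurable (S : set (measurableTypeR R)) by exact: countable_measurable.
have le (A : set (measurableTypeR R)) : measurable A -> (sigma A <= mu A)%E.
  move=> mA; have mAS := measurableI _ _ mA mS.
  have -> : sigma A = sigma (A `&` S).
    rewrite -[in LHS](setIT A) -(setUv S) setIUr measureU//; last 2 first.
    - exact/measurableI/measurableC.
    - by rewrite setIACA setICr setI0.
    rewrite [X in (_ + X)%E](_ : _ = 0%E) ?adde0//; apply/eqP.
    rewrite eq_le measure_ge0 andbT -sS le_measure// inE//.
      exact/measurableI/measurableC.
    exact: measurableC.
  apply: (@le_trans _ _ (mu (A `&` S))); last by rewrite le_measure// inE.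
  apply: le_measure_countable => //.
    exact: sub_countable (subset_card_le (@subIsetr _ _ _)) cS.
  by move=> x [_ Sx]; apply: atom_le_of_approximation => //; exact: H.
move=> A mA; apply/eqP; rewrite eq_le le// andbT.
have tot : mu setT = sigma setT.
  have := sm 0%N; under eq_integral do rewrite expr0.
  by under [RHS]eq_integral do rewrite expr0; rewrite !integral_cst// !mul1e.
have mC : measurable (~` A) by exact: measurableC.
have split_m (m : borel_measure R) : m setT = (m A + m (~` A))%E.
  by rewrite -(setUv A) measureU// setICr.
move: tot; rewrite !split_m => tot.
have fin (m : borel_measure R) B : finite_moments m -> measurable B -> m B \is a fin_num.
  by move=> fmm mB; rewrite ge0_fin_numE// finite_moments_lty.
rewrite -(leeD2rE _ _ (fin mu _ fm mC)) tot; apply: leeD2l; exact: le.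
Qed.

End determinacy_criterion.

(** * Removing infinitely many atoms *)

Section removal.
Context (R : realType).
Implicit Types (nu sigma : borel_measure R) (p q r : {poly R}) (s : seq R) (l : R).

Definition nodal s : {poly R} := \prod_(x <- s) ('X - x%:P).

Lemma nodal_cons x s : nodal (x :: s) = ('X - x%:P) * nodal s.
Proof. by rewrite /nodal big_cons. Qed.

Lemma nodal_neq0 s x : x \notin s -> (nodal s).[x] != 0.
Proof.
elim: s => [|y s IH]; first by rewrite /nodal big_nil hornerE oner_neq0.
rewrite inE negb_or => /andP[xy xs].
by rewrite nodal_cons hornerM hornerXsubC mulf_neq0 ?subr_eq0// IH.
Qed.

Lemma atom_le_integral nu (f : measurableTypeR R -> R) x : finite_moments nu ->
  tempered f -> (forall t, 0 <= f t) ->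
  f x * fine (nu [set x]) <= \int[nu]_t f t.
Proof.
move=> fnu tf f0.
have mx : measurable ([set x] : set (measurableTypeR R)) by exact: measurable_set1.
have tx : tempered (\1_[set x] : measurableTypeR R -> R) by exact: tempered_indic.
rewrite -Rintegral_indic// -Rintegral_temperedZ//; apply: le_Rintegral_tempered => //.
  exact: temperedZ.
move=> t; rewrite indicE; case: (boolP (_ \in _)) => [/set_mem ->|_].
  by rewrite mulr1.
by rewrite mulr0.
Qed.

(** Points are added one at a time.  Given [r] for [s], the value of
[nodal s * r] at the new point [x] is small because [nu] charges [x]; subtracting
the constant [r.[x]] from [r] makes [r] divisible by 'X - x at a small cost. *)
Lemma nodal_approximation nu l s e : N_extremal nu -> uniq s -> l \notin s ->
  (forall x, x \in s -> (0 < nu [set x])%E) -> 0 < e ->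
  exists r, \int[nu]_t (((nodal s * r).[t] - \1_[set l] t) ^+ 2) < e.
Proof.
move=> Nnu; have [[fnu _] _] := Nnu.
have ml : measurable ([set l] : set (measurableTypeR R)) by exact: measurable_set1.
have tl : tempered (\1_[set l] : measurableTypeR R -> R) by exact: tempered_indic.
elim: s e => [|x s IH] e.
  move=> _ _ _ e0; have [r hr] := indicator_approximation Nnu ml e0.
  by exists r; rewrite /nodal big_nil mul1r.
rewrite /= inE negb_or => /andP[xs us] /andP[lx ls] satom e0.
have x0 : 0 < fine (nu [set x]).
  apply: fine_gt0; apply/andP; split; first by apply: satom; exact: mem_head.
  by apply: finite_moments_lty => //; exact: measurable_set1.
have qx := nodal_neq0 xs.
have qx2 : 0 < (nodal s).[x] ^+ 2 by rewrite exprn_even_gt0.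
pose N := \int[nu]_t ((nodal s).[t] ^+ 2).
have tN : tempered (fun t : measurableTypeR R => (nodal s).[t] ^+ 2).
  by apply: temperedX; exact: tempered_poly.
have N0 : 0 <= N by apply: Rintegral_ge0 => t _; exact: sqr_ge0.
pose k := (nodal s).[x] ^+ 2 * fine (nu [set x]).
have k0 : 0 < k by exact: mulr_gt0.
(* if d is the squared error for s, that for x :: s is at most 2 d + 2 c^2 N with
   c = r.[x], and c^2 k <= d because of the atom at x *)
pose D := 2 + 2 * (N / k).
have D0 : 0 < D by rewrite ltr_wpDr// mulr_ge0// divr_ge0// ltW.
have [|r] := IH (e / D) us ls _ (divr_gt0 e0 D0).
  by move=> y ys; apply: satom; rewrite inE ys orbT.
set d := \int[nu]_t _ => hd.
pose c := r.[x].
have tr : tempered (fun t : measurableTypeR R => ((nodal s * r).[t] - \1_[set l] t) ^+ 2).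
  by apply: temperedX; apply: temperedB => //; exact: tempered_poly.
have ck : c ^+ 2 * k <= d.
  have := @atom_le_integral nu _ x fnu tr (fun t => sqr_ge0 _).
  rewrite -/d hornerM indicE memNset/=; last by move=> /= xl; rewrite xl eqxx in lx.
  by rewrite subr0 exprMn -/c [_ ^+ 2 * c ^+ 2]mulrC -mulrA.
exists ((r - c%:P) %/ ('X - x%:P)).
have -> : nodal (x :: s) * ((r - c%:P) %/ ('X - x%:P)) = nodal s * r - c *: nodal s.
  rewrite nodal_cons mulrC mulrA divpK; last first.
    by rewrite dvdp_XsubCl rootE hornerD hornerN hornerC subrr.
  by rewrite mulrBl mul_polyC [r * _]mulrC.
apply: (@le_lt_trans _ _ (2 * d + 2 * (c ^+ 2 * N))).
  have -> : 2 * d + 2 * (c ^+ 2 * N) = \int[nu]_t (2 * ((nodal s * r).[t] - \1_[set l] t) ^+ 2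
      + 2 * (c ^+ 2 * (nodal s).[t] ^+ 2)).
    rewrite Rintegral_temperedD//; [|exact: temperedZ|exact/temperedZ/temperedZ].
    by rewrite !Rintegral_temperedZ//; exact: temperedZ.
  apply: le_Rintegral_tempered => //.
  - by apply: temperedX; apply: temperedB => //; exact: tempered_poly.
  - by apply: temperedD; [exact: temperedZ|exact/temperedZ/temperedZ].
  - move=> t; rewrite hornerD hornerN hornerZ -exprMn.
    set a := (nodal s * r).[t]; set b := \1_[set l] t; set z := c * _.
    by have := sqr_ge0 (a - b + z); nra.
have cN : c ^+ 2 * N <= d * (N / k).
  by rewrite [d * _]mulrCA -[leLHS]mulrC ler_wpM2l// ler_pdivlMr.
apply: (@le_lt_trans _ _ (d * D)); first by rewrite /D; lra.
by rewrite -ltr_pdivlMr.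
Qed.

Lemma isolated_weight x (S : set R) (e : R) : 0 < e ->
  (forall t, S t -> e <= `|t - x|) ->
  exists2 C, 0 <= C & forall t, S t -> 1 + t ^+ 2 <= C * (t - x) ^+ 2.
Proof.
move=> e0 H; exists (2 + (1 + 2 * x ^+ 2) / e ^+ 2) => [|t St].
  by rewrite addr_ge0// divr_ge0 ?sqr_ge0// addr_ge0// mulr_ge0// sqr_ge0.
have et : e ^+ 2 <= (t - x) ^+ 2.
  by rewrite -[leRHS]real_normK ?num_real// ler_sqr ?nnegrE ?(ltW e0)// H.
have : 1 + 2 * x ^+ 2 <= (1 + 2 * x ^+ 2) / e ^+ 2 * (t - x) ^+ 2.
  have x1 : 0 <= 1 + 2 * x ^+ 2 by rewrite addr_ge0// mulr_ge0// sqr_ge0.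
  rewrite -mulrA ler_peMr//.
  by rewrite mulrC ler_pdivlMr ?exprn_gt0// mul1r.
have := sqr_ge0 (t - 2 * x); nra.
Qed.

Lemma nodal_weight s (S : set R) :
  (forall x, x \in s -> exists2 e, 0 < e & forall t, S t -> e <= `|t - x|) ->
  exists2 C, 0 <= C &
    forall t, S t -> (1 + t ^+ 2) ^+ size s <= C * (nodal s).[t] ^+ 2.
Proof.
elim: s => [|x s IH] H.
  by exists 1 => // t _; rewrite /nodal big_nil expr0 hornerC expr1n mulr1.
have [|C C0 hC] := IH; first by move=> y ys; apply: H; rewrite inE ys orbT.
have [e e0 he] := H x (mem_head _ _).
have [D D0 hD] := isolated_weight e0 he.
exists (D * C) => [|t St]; first exact: mulr_ge0.
rewrite [size _]/= (exprS (1 + t ^+ 2)) nodal_cons hornerM hornerXsubC exprMn mulrACA.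
apply: ler_pM; [|apply: exprn_ge0|exact: hD|exact: hC];
  by rewrite addr_ge0// sqr_ge0.
Qed.

End removal.

Section remaining_measure.
Context (R : realType) (nu : borel_measure R) (Omega' : set R).
Hypotheses (Nnu : N_extremal nu) (sub : Omega' `<=` supp nu) (inf : infinite_set Omega').
Implicit Types (sigma : borel_measure R).

Let S : set (measurableTypeR R) := supp nu `\` Omega'.

Let fnu : finite_moments nu. Proof. by case: Nnu => -[]. Qed.

Let measurable_singleton (x : measurableTypeR R) : measurable [set x].
Proof. exact: measurable_set1. Qed.

Lemma supp_countable : countable (supp nu).
Proof.
rewrite (_ : supp nu = isolated (supp nu)); first exact: countable_isolated.
apply/seteqP; split => [x sx|x /isolatedS//].
have [_ [e e0 he]] := supp_isolated Nnu sx.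
split; first exact/mem_set.
exists (ball x e); first exact: nbhsx_ballx.
apply/seteqP; split => [y [xy sy]|_ ->]; last by split => //; exact: ballxx.
apply/eqP; apply: contraT => yx; have := he y sy yx.
by rewrite leNgt distrC => /negP; case.
Qed.

Let countable_S : countable S.
Proof. exact: sub_countable (subset_card_le (@subDsetl _ _ _)) supp_countable. Qed.

Let measurable_S : measurable S.
Proof. exact: countable_measurable. Qed.

(** A measure dominated by [C * (1 + t^2)^m * nu] on the remaining support is
determinate: [m.+1] removed points compensate this weight together with the
extra factor 1 + t^2 of the criterion. *)
Lemma determinate_of_domination sigma (C : R) m : 0 <= C ->
  (forall g : measurableTypeR R -> R, tempered g -> (forall t, 0 <= g t) ->
    (\int[sigma]_t (g t)%:E <=
     \int[nu]_(t in S) (g t * (C * (1 + (t : R) ^+ 2) ^+ m))%:E)%E) ->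
  H_determinate sigma.
Proof.
move=> C0 dom.
have tw n : tempered (fun t : measurableTypeR R => C * (1 + (t : R) ^+ 2) ^+ n).
  apply: temperedZ; apply: temperedX; apply: temperedD; first exact: tempered_cst.
  exact: tempered_pow.
have w0 n (t : R) : 0 <= C * (1 + t ^+ 2) ^+ n.
  by rewrite mulr_ge0// exprn_ge0// addr_ge0// sqr_ge0.
have boundS (g h : measurableTypeR R -> R) : tempered g -> (forall t, 0 <= g t) ->
    tempered h -> (forall t, 0 <= h t) ->
    (forall t, S t -> g t * (C * (1 + (t : R) ^+ 2) ^+ m) <= h t) ->
    (\int[sigma]_t (g t)%:E <= (\int[nu]_t h t)%R%:E)%E.
  move=> tg g0 th h0 gh; apply: le_trans (dom g tg g0) _.
  have mh : measurable_fun [set: measurableTypeR R] (fun t => (h t)%:E).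
    by apply/measurable_EFinP; exact: (tempered_measurable th).
  have mg : measurable_fun [set: measurableTypeR R]
      (fun t => (g t * (C * (1 + (t : R) ^+ 2) ^+ m))%:E).
    by apply/measurable_EFinP; exact: (tempered_measurable (temperedM tg (tw m))).
  rewrite -integral_tempered//.
  apply: (@le_trans _ _ (\int[nu]_(t in S) (h t)%:E)%E).
    apply: ge0_le_integral => //.
    - by move=> t _; rewrite lee_fin mulr_ge0.
    - exact: measurable_funTS.
    - exact: measurable_funTS.
  by apply: ge0_subset_integral => // t _; rewrite lee_fin.
have fsigma : finite_moments sigma.
  move=> n.
  have tn : tempered (fun t : measurableTypeR R => `|t : R| ^+ n).
    apply: temperedX; split; first exact: normr_measurable.
    have [_ [D [k hD]]] := tempered_id R.
    by exists D, k => t; rewrite normr_id.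
  pose h (t : measurableTypeR R) := `|t : R| ^+ n * (C * (1 + (t : R) ^+ 2) ^+ m).
  apply: le_lt_trans (boundS _ h tn _ _ _ _) _.
  - by move=> t; exact: exprn_ge0.
  - exact: temperedM.
  - by move=> t; rewrite mulr_ge0// exprn_ge0.
  - by [].
  - by rewrite ltry.
apply: (@determinate_of_approximation _ _ S) => //.
  have mCS : measurable (~` S) by exact: measurableC.
  apply/eqP; rewrite eq_le measure_ge0 andbT.
  have -> : sigma (~` S) = (\int[sigma]_t (\1_(~` S) t : R)%:E)%E.
    by rewrite integral_indic// setIT.
  apply: le_trans (boundS _ (cst 0) _ _ _ _ _) _.
  - exact: tempered_indic.
  - by move=> t.
  - exact: tempered_cst.
  - by [].
  - by move=> t St; rewrite indicE memNset ?mul0r//= => /(_ St).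
  - by rewrite Rintegral_cst// mul0r.
move=> l [sl l'] e e0.
have [B BO Bm] := infinite_set_fset m.+1 inf.
pose s : seq R := take m.+1 (finmap.enum_fset B).
have ss : size s = m.+1 by rewrite size_takel.
have sO x : x \in s -> Omega' x by move=> /mem_take xB; exact: BO.
have us : uniq s by rewrite take_uniq// finmap.fset_uniq.
have ls : l \notin s by apply/negP => /sO.
have satom x : x \in s -> (0 < nu [set x])%E.
  by move=> /sO /sub /(supp_isolated Nnu)[].
have [D D0 hD] : exists2 D, 0 <= D &
    forall t, S t -> (1 + t ^+ 2) ^+ size s <= D * (nodal s).[t] ^+ 2.
  apply: nodal_weight => x /sO Ox.
  have [_ [d d0 hd]] := supp_isolated Nnu (sub Ox).
  exists d => // t [st t']; apply: hd => //.
  by apply/eqP => tx; apply: t'; rewrite tx.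
pose ql := (nodal s).[l].
pose E := C * D * ql ^+ 2 + 1.
have E1 : 0 <= C * D * ql ^+ 2 by rewrite mulr_ge0 ?sqr_ge0// mulr_ge0.
have E0 : 0 < E by rewrite ltr_wpDl.
(* the approximation of 1_l by q r becomes one of q(l) 1_l by q (q(l) r) *)
have [r hr] := nodal_approximation Nnu us ls satom (divr_gt0 e0 E0).
exists (ql *: r).
have ml : measurable ([set l] : set (measurableTypeR R)) by [].
have tl : tempered (\1_[set l] : measurableTypeR R -> R) by exact: tempered_indic.
pose f (t : measurableTypeR R) : R := ((nodal s * r).[t] - \1_[set l] t) ^+ 2.
have tf : tempered f.
  by apply: temperedX; apply: temperedB => //; exact: tempered_poly.
have f0 t : 0 <= f t by exact: sqr_ge0.
have tg : tempered (fun t : measurableTypeR R =>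
    ((ql *: r).[t] - \1_[set l] t) ^+ 2 * (1 + (t : R) ^+ 2)).
  apply: temperedM.
    by apply: temperedX; apply: temperedB => //; exact: tempered_poly.
  by apply: temperedD; [exact: tempered_cst|exact: tempered_pow].
rewrite -lte_fin -integral_tempered//.
apply: le_lt_trans (boundS _ (fun t => C * D * ql ^+ 2 * f t) tg _ _ _ _) _.
- by move=> t; rewrite mulr_ge0 ?sqr_ge0// addr_ge0// sqr_ge0.
- exact: temperedZ.
- by move=> t; exact: mulr_ge0.
- move=> t St; have := hD t St; rewrite ss exprS => hDt.
  have -> : ((ql *: r).[t] - \1_[set l] t) ^+ 2 * (1 + t ^+ 2) * (C * (1 + t ^+ 2) ^+ m) =
    C * ((ql *: r).[t] - \1_[set l] t) ^+ 2 * ((1 + t ^+ 2) * (1 + t ^+ 2) ^+ m) by ring.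
  apply: le_trans (ler_wpM2l _ hDt) _; first by rewrite mulr_ge0// sqr_ge0.
  rewrite /f hornerZ hornerM indicE; case: (boolP (_ \in _)) => [/set_mem ->|_] /=.
    by rewrite -/ql le_eqVlt; apply/orP; left; apply/eqP; ring.
  by rewrite le_eqVlt; apply/orP; left; apply/eqP; ring.
rewrite lte_fin Rintegral_temperedZ//.
apply: (@le_lt_trans _ _ (E * \int[nu]_t f t)); last by rewrite mulrC -ltr_pdivlMr.
rewrite ler_wpM2r//; first by apply: Rintegral_ge0 => t _.
by rewrite lerDl.
Qed.

Let rho : borel_measure R := atomic_measure nu S.

Let rho_null : rho (~` S) = 0%E.
Proof.
rewrite /rho /= /atomic_measure esum1// => l Sl.
by rewrite diracE memNset ?mule0// => /(_ Sl).
Qed.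

Let rho_atom x : S x -> rho [set x] = nu [set x].
Proof.
move=> Sx; rewrite /rho /= /atomic_measure.
rewrite (_ : esum _ _ = \esum_(l in S) (if l \in [set x] then nu [set l] else 0%E)).
  rewrite -esum_mkcondr (_ : S `&` [set x] = [set x]) ?esum_set1//.
  by apply/seteqP; split => [y []|_ ->].
apply: eq_esum => l Sl; rewrite diracE; case: ifPn => lx.
  by rewrite mule1.
by rewrite mule0.
Qed.

Let rho_le (A : set (measurableTypeR R)) : measurable A -> (rho A <= nu A)%E.
Proof.
move=> mA; have mAS := measurableI _ _ mA measurable_S.
have mCS : measurable (~` S) by exact: measurableC.
have -> : rho A = rho (A `&` S).
  rewrite -[in LHS](setIT A) -(setUv S) setIUr measureU//; last 2 first.
  - exact: measurableI.
  - by rewrite setIACA setICr setI0.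
  rewrite [X in (_ + X)%E](_ : _ = 0%E) ?adde0//; apply/eqP.
  by rewrite eq_le measure_ge0 andbT -rho_null le_measure// inE//; exact: measurableI.
apply: (@le_trans _ _ (nu (A `&` S))); last by rewrite le_measure// inE.
apply: le_measure_countable => //.
  exact: sub_countable (subset_card_le (@subIsetr _ _ _)) countable_S.
by move=> x [_ Sx]; rewrite rho_atom.
Qed.

Let integral_rho_le (g : measurableTypeR R -> R) : tempered g -> (forall t, 0 <= g t) ->
  (\int[rho]_t (g t)%:E <= \int[nu]_(t in S) (g t)%:E)%E.
Proof.
move=> tg g0.
have mg : measurable_fun [set: measurableTypeR R] (fun t => (g t)%:E).
  by apply/measurable_EFinP; exact: (tempered_measurable tg).
rewrite (ge0_negligible_integral (N := ~` S))//; last 2 first.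
- exact: measurableC.
- by move=> t _; rewrite lee_fin.
by rewrite setTD setCK; exact: ge0_le_measure_integral.
Qed.

Lemma removal_determinate : H_determinate rho.
Proof.
apply: (@determinate_of_domination _ 1 0) => // g tg g0.
apply: le_trans (integral_rho_le tg g0) _.
rewrite [leRHS](eq_integral (fun t => (g t)%:E))// => t _.
by rewrite expr0 !mulr1.
Qed.

Section power_weight.
Variables (z : R[i]) (k : nat).

Let w (t : measurableTypeR R) : R := Normc.normc ((t : R)%:C - z)%C ^+ (2 * k).

Let wE t : w t = ((t - complex.Re z) ^+ 2 + complex.Im z ^+ 2) ^+ k.
Proof.
rewrite /w exprM; congr (_ ^+ k); case: z => a b /=.
by rewrite sqr_sqrtr ?addr_ge0 ?sqr_ge0// sub0r sqrrN.
Qed.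

Let w_ge0 t : 0 <= w t.
Proof. by rewrite wE exprn_ge0// addr_ge0// sqr_ge0. Qed.

Let tempered_w : tempered w.
Proof.
rewrite (funext wE); apply: temperedX; apply: temperedD; last exact: tempered_cst.
by apply: temperedX; apply: temperedB; [exact: tempered_id|exact: tempered_cst].
Qed.

Let w_le t :
  w t <= (2 + 2 * complex.Re z ^+ 2 + complex.Im z ^+ 2) ^+ k * (1 + (t : R) ^+ 2) ^+ k.
Proof.
rewrite wE -exprMn; set a := complex.Re z; set b := complex.Im z.
have h0 : 0 <= (t - a) ^+ 2 + b ^+ 2 by rewrite addr_ge0// sqr_ge0.
rewrite lerXn2r ?nnegrE//.
  by rewrite mulr_ge0// !addr_ge0// ?sqr_ge0// mulr_ge0// sqr_ge0.
have := sqr_ge0 (t + a).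
have : 0 <= (t : R) ^+ 2 * a ^+ 2 by rewrite mulr_ge0// sqr_ge0.
have : 0 <= (t : R) ^+ 2 * b ^+ 2 by rewrite mulr_ge0// sqr_ge0.
nra.
Qed.

Import HBNNSimple.

(* A simple function h <= g is integrated level set by level set, which gives the
   integral of h w; the bound then passes to the supremum over h. *)
Let integral_weighted_le (m : borel_measure R) (g : measurableTypeR R -> R) :
  tempered g -> (forall t, 0 <= g t) ->
  (\int[power_weighted_measure m z k]_t (g t)%:E <= \int[m]_t (g t * w t)%:E)%E.
Proof.
move=> tg g0.
have mw : measurable_fun [set: measurableTypeR R] w by exact: (tempered_measurable tempered_w).
rewrite ge0_integralTE; last by move=> t; rewrite lee_fin.
apply: ge_ereal_sup => _ [h /= hg] <-.
have mhr (r : R) : measurable (h @^-1` [set r]) by exact: measurable_funPTI.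
(* |r| instead of r keeps F nonnegative outside the range of h as well *)
pose F (r : R) (t : measurableTypeR R) : \bar R :=
  (`|r|%:E * (\1_(h @^-1` [set r]) t * w t)%:E)%E.
have mF0 r : measurable_fun [set: measurableTypeR R]
    (fun t => (\1_(h @^-1` [set r]) t * w t)%:E).
  apply/measurable_EFinP; apply: measurable_funM => //; exact: measurable_indic.
have F0 r t : (0 <= F r t)%E by rewrite /F -EFinM lee_fin !mulr_ge0.
have piece (r : R) : range h r ->
    (r%:E * power_weighted_measure m z k (h @^-1` [set r]) = \int[m]_t F r t)%E.
  move=> [t _ <-]; rewrite ge0_integralZl//; last by move=> x _; rewrite lee_fin mulr_ge0.
  rewrite ger0_norm//.
  congr (_ * _)%E; rewrite /= /power_weighted_measure integral_mkcond.
  apply: eq_integral => x _; rewrite /patch indicE; case: ifP => _.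
    by rewrite mul1r.
  by rewrite mul0r.
rewrite sintegralE (eq_fsbigr (fun r => \int[m]_t F r t)%E); last first.
  by move=> r /set_mem; exact: piece.
rewrite -ge0_integral_fsum//; last by move=> r; exact: measurable_funeM.
have sumF x : (\sum_(r \in range h) F r x)%E = (h x * w x)%:E.
  rewrite (fsbigD1 (h x))//=; last by exists x.
  rewrite fsbig1 ?adde0 => [|r [_ /= rx]].
    by rewrite /F indicE mem_set// mul1r ger0_norm.
  by rewrite /F indicE memNset ?mul0r ?mule0// => /= hx; exact: rx.
under eq_integral do rewrite sumF.
apply: ge0_le_integral => //.
- by move=> t _; rewrite lee_fin mulr_ge0.
- by apply/measurable_EFinP; exact: measurable_funM.
- by apply/measurable_EFinP; apply: measurable_funM => //; exact: (tempered_measurable tg).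
- by move=> t _; rewrite lee_fin ler_wpM2r// -lee_fin.
Qed.

Lemma removal_weighted_determinate : H_determinate (power_weighted_measure rho z k).
Proof.
apply: (@determinate_of_domination _
  ((2 + 2 * complex.Re z ^+ 2 + complex.Im z ^+ 2) ^+ k) k).
  by rewrite exprn_ge0// !addr_ge0// ?sqr_ge0// mulr_ge0// sqr_ge0.
move=> g tg g0; apply: le_trans (integral_weighted_le _ tg g0) _.
apply: le_trans (integral_rho_le (temperedM tg tempered_w) _) _.
  by move=> t; exact: mulr_ge0.
apply: ge0_le_integral => //.
- by move=> t _; rewrite lee_fin mulr_ge0.
- apply: measurable_funTS; apply/measurable_EFinP.
  exact: (tempered_measurable (temperedM tg tempered_w)).
- apply: measurable_funTS; apply/measurable_EFinP; apply: tempered_measurable.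
  apply: temperedM => //; apply: temperedZ; apply: temperedX; apply: temperedD.
    exact: tempered_cst.
  exact: tempered_pow.
- by move=> t _; rewrite lee_fin ler_wpM2l.
Qed.

End power_weight.

Lemma removal_index z : H_index rho z = +oo%E.
Proof.
apply: eq_infty => r; apply: (@le_trans _ _ ((Num.truncn r).+1%:R)%:E).
  by rewrite lee_fin ltW// truncnS_gt.
apply: ereal_sup_ubound; exists (Num.truncn r).+1 => //.
exact: removal_weighted_determinate.
Qed.

End remaining_measure.

Local Open Scope ereal_scope.

Theorem theorem2p4p1 (R : realType) (nu : borel_measure R) (Omega' : set R) :
  N_extremal nu ->
  Omega' `<=` supp nu ->
  infinite_set Omega' ->
  let rho := atomic_measure nu (supp nu `\` Omega') in
  H_determinate rho /\ forall z : R[i], H_index rho z = +oo.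
Proof.
move=> Nnu sub inf rho; split.
  exact: removal_determinate Nnu sub inf.
exact: removal_index Nnu sub inf.
Qed.
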